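(* For integers $d\geq 1$ and $l\geq 2$, let $f_{d,l}=y^{l}+x-x^{d}z\in\mathbb{C}[x,y,z]$ and let $U_{d,l}=\mathbb{A}^{3}\setminus\{f_{d,l}=0\}=\mathrm{Spec}\big(\mathbb{C}[x,y,z]_{f_{d,l}}\big)$. Then the threefolds $U_{d,l}$, $d\geq 1$, $l\geq 2$, are pairwise non-isomorphic; that is, if $d,d'\geq 1$ and $l,l'\geq 2$ are integers such that $U_{d,l}$ and $U_{d',l'}$ are isomorphic as algebraic varieties over $\mathbb{C}$, then $(d,l)=(d',l')$.
   Context: All varieties are over the field $\mathbb{C}$ of complex numbers, and $\mathbb{A}^{n}$ denotes affine $n$-space over $\mathbb{C}$. For $f\in\mathbb{C}[x,y,z]$, $\mathbb{C}[x,y,z]_{f}$ denotes the localization at the powers of $f$. Isomorphism means isomorphism of complex algebraic varieties (equivalently, since all varieties here are affine, isomorphism of their coordinate rings as $\mathbb{C}$-algebras). *)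

(* Defs.v *)
From HB Require Import structures.
From mathcomp Require Import all_boot all_algebra.
From mathcomp Require Import boolp reals.
From mathcomp Require Import complex.
From mathcomp Require Import mpoly.

Set Implicit Arguments.
Unset Strict Implicit.
Unset Printing Implicit Defensive.

Import GRing.Theory.
Local Open Scope ring_scope.

Local Notation "p %:F" := (@FracField.tofrac _ p).

Section Localization.
Variables (K : idomainType) (n : nat) (f : {mpoly K[n]}).

(* Since K[X] is a domain, its localization at the powers of a nonzero f is
   the subring of Frac(K[X]) made of the fractions p / f ^ k. (For f = 0 this
   gives K[X], because 0^-1 = 0, and not the zero ring.) *)
Definition mploc_pred : pred {fraction {mpoly K[n]}} :=
  fun u => `[< exists (p : {mpoly K[n]}) (k : nat), u = p%:F / f%:F ^+ k >].

Fact mploc_subring_closed : subring_closed mploc_pred.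
Proof.
have [f0|fN0] := eqVneq f 0.
  have P u : u \in mploc_pred -> exists p : {mpoly K[n]}, u = p%:F.
    move=> /asboolP[p [[|k] ->]]; first by exists p; rewrite expr0 divr1.
    by exists 0; rewrite f0 tofrac0 exprS mul0r invr0 mulr0.
  have Q (p : {mpoly K[n]}) : p%:F \in mploc_pred.
    by apply/asboolP; exists p, 0%N; rewrite expr0 divr1.
  split=> [|u v /P[p ->] /P[q ->]|u v /P[p ->] /P[q ->]].
  - by rewrite -tofrac1 Q.
  - by rewrite -tofracB Q.
  - by rewrite -tofracM Q.
have FN0 k : f%:F ^+ k != 0 by rewrite expf_neq0 ?tofrac_eq0.
split=> [|u v /asboolP[p [k ->]] /asboolP[q [m ->]]
         |u v /asboolP[p [k ->]] /asboolP[q [m ->]]]; apply/asboolP.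
- by exists 1, 0%N; rewrite tofrac1 expr0 divr1.
- exists (p * f ^+ m - q * f ^+ k), (k + m)%N.
  rewrite tofracB !tofracM !tofracXn exprD -mulNr addf_div ?FN0 //.
  by rewrite mulNr.
- exists (p * q), (k + m)%N.
  by rewrite tofracM exprD mulf_div.
Qed.

HB.instance Definition _ :=
  GRing.isSubringClosed.Build _ mploc_pred mploc_subring_closed.

Record mploc := MPLoc {
  mploc_val : {fraction {mpoly K[n]}};
  _ : mploc_val \in mploc_pred
}.

HB.instance Definition _ := [isSub for mploc_val].
HB.instance Definition _ := [Choice of mploc by <:].
HB.instance Definition _ := [SubChoice_isSubComNzRing of mploc by <:].

Fact mploc_of_proof (p : {mpoly K[n]}) : p%:F \in mploc_pred.
Proof. by apply/asboolP; exists p, 0%N; rewrite expr0 divr1. Qed.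

Definition mploc_of (p : {mpoly K[n]}) : mploc := MPLoc (mploc_of_proof p).

Fact mploc_of_zmod_morphism : zmod_morphism mploc_of.
Proof. by move=> p q; apply: val_inj; rewrite raddfB /= tofracB. Qed.
HB.instance Definition _ :=
  GRing.isZmodMorphism.Build _ _ mploc_of mploc_of_zmod_morphism.

Fact mploc_of_monoid_morphism : monoid_morphism mploc_of.
Proof.
split=> [|p q]; apply: val_inj; first by rewrite rmorph1 /= tofrac1.
by rewrite rmorphM /= tofracM.
Qed.
HB.instance Definition _ :=
  GRing.isMonoidMorphism.Build _ _ mploc_of mploc_of_monoid_morphism.

Definition mploc_scale (c : K) (u : mploc) : mploc := mploc_of c%:MP * u.

Fact mploc_scaleA a b u :
  mploc_scale a (mploc_scale b u) = mploc_scale (a * b) u.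
Proof. by rewrite /mploc_scale mulrA -rmorphM /= -mpolyCM. Qed.

Fact mploc_scale1 : left_id 1 mploc_scale.
Proof. by move=> u; rewrite /mploc_scale mpolyC1 rmorph1 mul1r. Qed.

Fact mploc_scaleDr : right_distributive mploc_scale +%R.
Proof. by move=> c u v; rewrite /mploc_scale mulrDr. Qed.

Fact mploc_scaleDl u : {morph mploc_scale^~ u : a b / a + b}.
Proof. by move=> a b; rewrite /mploc_scale mpolyCD rmorphD mulrDl. Qed.

HB.instance Definition _ := GRing.Zmodule_isLmodule.Build K mploc
  mploc_scaleA mploc_scale1 mploc_scaleDr mploc_scaleDl.

Fact mploc_scaleAl (c : K) (u v : mploc) : c *: (u * v) = (c *: u) * v.
Proof. exact: mulrA. Qed.
HB.instance Definition _ := GRing.Lmodule_isLalgebra.Build K mploc mploc_scaleAl.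
HB.instance Definition _ := GRing.Lalgebra_isComAlgebra.Build K mploc.

End Localization.

Definition isomorphic_algebras (K : nzRingType) (A B : lalgType K) : Prop :=
  exists phi : {lrmorphism A -> B}, bijective phi.

Definition f_poly (R : realType) (d l : nat) : {mpoly R[i][3]} :=
  let x := 'X_(0 : 'I_3) in
  let y := 'X_(1 : 'I_3) in
  let z := 'X_(2 : 'I_3) in
  y ^+ l + x - x ^+ d * z.

Fact f_poly_neq0 (R : realType) (d l : nat) :
  (2 <= l)%N -> f_poly R d l != 0.
Proof.
move=> l2; apply/eqP => /mpolyP/(_ (mnm1 (0 : 'I_3))).
rewrite mcoeff0 /f_poly mcoeffB mcoeffD !mpolyXn -!mpolyXD !mcoeffX eqxx /=.
case: eqP => [/mnmP/(_ 0)|_]; first by rewrite mulmnE !mnmE.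
case: eqP => [/mnmP/(_ 2%:R)|_]; first by rewrite mnmDE mulmnE !mnmE.
by rewrite add0r subr0 => /eqP; rewrite oner_eq0.
Qed.

(* The affine threefold U_(d, l), given through its coordinate ring: the
   category of affine varieties is dual to that of their coordinate rings. *)
Definition coordU (R : realType) (d l : nat) : comAlgType R[i] :=
  mploc (f_poly R d l).

(* Main.v *)
Require Import Defs.
From HB Require Import structures.
From mathcomp Require Import all_boot all_order all_algebra.
From mathcomp Require Import polyXY ring zify.
From mathcomp Require Import boolp reals complex mpoly.

(* Write t for the equation f. In the localization U, x ^ d z = y ^ l + x - t, and U
   embeds in C[t^{+-1}, x^{+-1}, y]; it carries the Poisson bracket - Jac(f, ., .),
   whose Casimir t is, up to constants and powers, the only unit. An isomorphism
   therefore maps derivations killing t to derivations killing t.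

   If d, l >= 2, comparing leading terms (degree in y, then in x) shows that every
   locally nilpotent derivation D of U with D t = 0 kills x. For d = 1 the Hamiltonian
   derivations of x and of 1 - z are both locally nilpotent, with different kernels,
   which separates d = 1 from d >= 2. If both exponents d, d' are at least 2, an
   isomorphism maps x' to a unit times x and y' to s y + r with s, r in C[t^{+-1}, x];
   this yields d <= d' and, from the image of z', l <= l'.

   If d = d' = 1, the isomorphism multiplies the bracket by a unit. For lam <> 0, the
   quotient of U by the brackets and by t - lam has dimension l - 1: it is
   C[y] / ((y ^ l - lam) C[y])', read off on the coefficient of x ^ 0. Hence l = l'. *)

Set Implicit Arguments.
Unset Strict Implicit.
Unset Printing Implicit Defensive.

Import Order.TTheory GRing.Theory Num.Theory.
Local Open Scope ring_scope.

(** * Derivations and leading terms *)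

(** In C[t^{+-1}, x^{+-1}, y] the element z has degree l in y and a pole of order d in x. For an
    element of U of degree j in y, the coefficient of y ^ j has x-order at least - d floor(j / l),
    and below degree l there is no pole at all. This bound is what is used to recognize U inside the
    larger ring, and d and l are read off from it.

    A derivation multiplies a leading monomial x ^ v y ^ j by a weight linear in (v, j). Local
    nilpotency makes the weight vanish somewhere on the orbits of x, y and z; together with the
    bound this has no integer solution when d, l >= 2. For d = 1 the argument must fail: with w = 1
    - z the relation reads x w = t - y ^ l, symmetric in x and w, so x is not singled out and l has
    to come from an invariant of the bracket itself. There t' goes to a t ^ m with m <> 0, and lam
    is chosen with a lam ^ m = 1, so that the level lam of t matches the level 1 of t'. *)

Record is_derivation (K : nzRingType) (U : lalgType K) (D : U -> U) : Prop :=
  IsDerivation {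
    derD : forall a b, D (a + b) = D a + D b;
    derM : forall a b, D (a * b) = D a * b + a * D b;
    derZ : forall c a, D (c *: a) = c *: D a }.

Section Derivations.
Variables (K : nzRingType) (U : comAlgType K).
Implicit Types (D : U -> U) (a b u : U).

Section One.
Variables (D : U -> U) (derD_ : is_derivation D).

Lemma der0 : D 0 = 0.
Proof. by have := derZ derD_ 0 0; rewrite !scale0r. Qed.

Lemma derN a : D (- a) = - D a.
Proof. by rewrite -scaleN1r (derZ derD_) scaleN1r. Qed.

Lemma der1 : D 1 = 0.
Proof.
have := derM derD_ 1 1; rewrite !mulr1 mul1r => /eqP.
by rewrite -{1}[D 1]addr0 (inj_eq (addrI _)) eq_sym => /eqP.
Qed.

Lemma der_scalar (c : K) : D c%:A = 0.
Proof. by rewrite (derZ derD_) der1 scaler0. Qed.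

Lemma derX a n : D (a ^+ n) = (n%:R * a ^+ n.-1) * D a.
Proof.
elim: n => [|n IHn]; first by rewrite expr0 der1 !mul0r.
rewrite exprS (derM derD_) IHn /=; case: n {IHn} => [|n] /=.
  by rewrite expr0; ring.
by rewrite -natr1 exprS; ring.
Qed.

Lemma der_iterD n a b : iter n D (a + b) = iter n D a + iter n D b.
Proof. by elim: n => //= n ->; rewrite (derD derD_). Qed.

Lemma der_iter0 n : iter n D 0 = 0.
Proof. by elim: n => //= n ->; rewrite der0. Qed.

Lemma der_iter_const a n u : D a = 0 -> iter n D (a * u) = a * iter n D u.
Proof.
by move=> Da; elim: n => //= n ->; rewrite (derM derD_) Da mul0r add0r.
Qed.

End One.

Definition loc_nilpotent D := forall u, exists n, iter n D u = 0.

Lemma iter0_le D n m u : is_derivation D -> (n <= m)%N ->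
  iter n D u = 0 -> iter m D u = 0.
Proof.
by move=> hD /subnK <- h; rewrite iterD h der_iter0.
Qed.

Lemma nilpD D u v : is_derivation D ->
  (exists n, iter n D u = 0) -> (exists n, iter n D v = 0) ->
  exists n, iter n D (u + v) = 0.
Proof.
move=> hD [n un] [m vm]; exists (maxn n m); rewrite der_iterD //.
by rewrite !(iter0_le hD _ un, iter0_le hD _ vm) ?leq_maxl ?leq_maxr ?addr0.
Qed.

(** Induction on the sum of the two nilpotency orders: each Leibniz term of [D (u * v)] lowers one
    of them. *)
Lemma nilpM D u v : is_derivation D ->
  (exists n, iter n D u = 0) -> (exists n, iter n D v = 0) ->
  exists n, iter n D (u * v) = 0.
Proof.
move=> hD [n un] [m vm]; exists (n + m)%N.
have [s e] : exists s, (n + m = s)%N by exists (n + m)%N.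
rewrite e; elim: s n m e u v un vm => [|s IHs] n m e u v un vm.
  by case: n e un => //= _ ->; rewrite mul0r.
rewrite iterSr (derM hD) der_iterD //.
have zero_l k : iter k D (0 * v) = 0 by rewrite mul0r der_iter0.
have -> : iter s D (D u * v) = 0.
  case: n e un => [|n] e un; last first.
    by apply: (IHs n m) => //; [lia | rewrite -iterSr].
  by rewrite /= in un; rewrite un der0 // zero_l.
case: m e vm => [|m] e vm; rewrite add0r.
  by rewrite /= in vm; rewrite vm der0 // mulr0 der_iter0.
by apply: (IHs n m) => //; [lia | rewrite -iterSr].
Qed.

End Derivations.

Section PolyTop.
Variable A : idomainType.
Implicit Types P Q : {poly {poly A}}.

(* [c] is the coefficient of [Y^j X^i] in [P], and all other monomials are
   smaller for the order that compares first the degree in Y, then in X;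
   [c] may vanish, which makes the relation compatible with sums. *)
Definition top P (j i : nat) (c : A) : Prop :=
  [/\ (size P <= j.+1)%N, (size (P`_j)%R <= i.+1)%N & P`_j`_i = c].

Lemma coef_top (B : nzRingType) (p q : {poly B}) m n :
  (size p <= m.+1)%N -> (size q <= n.+1)%N -> (p * q)`_(m + n) = p`_m * q`_n.
Proof.
move=> sp sq; rewrite coefM.
have hm : (m < (m + n).+1)%N by rewrite ltnS leq_addr.
rewrite (bigD1 (Ordinal hm)) //= (addKn m n) big1 ?addr0 // => -[i hi] /=.
rewrite -val_eqE /= => ne; case: (ltngtP i m) ne => // h _.
  by rewrite [q`__]nth_default ?mulr0 //; apply: leq_trans sq _; lia.
by rewrite nth_default ?mul0r //; apply: leq_trans sp _.
Qed.

Lemma size_mul_top (B : nzRingType) (p q : {poly B}) m n :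
  (size p <= m.+1)%N -> (size q <= n.+1)%N -> (size (p * q)%R <= (m + n).+1)%N.
Proof.
by move=> sp sq; apply: leq_trans (size_polyMleq _ _) _; lia.
Qed.

Lemma size_deriv_le (B : nzRingType) (p : {poly B}) : (size p^`() <= (size p).-1)%N.
Proof.
have [->|p0] := eqVneq p 0; first by rewrite deriv0 size_poly0.
by have := lt_size_deriv p0; case: (size p).
Qed.

Lemma topD P Q j i c c' : top P j i c -> top Q j i c' -> top (P + Q) j i (c + c').
Proof.
move=> [s1 s2 s3] [s4 s5 s6]; split; rewrite ?coefD ?s3 ?s6 //.
  by apply: leq_trans (size_polyD _ _) _; rewrite geq_max s1.
by apply: leq_trans (size_polyD _ _) _; rewrite geq_max s2.
Qed.

Lemma topN P j i c : top P j i c -> top (- P) j i (- c).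
Proof. by case=> s1 s2 s3; split; rewrite ?coefN ?s3 // size_polyN. Qed.

Lemma topM P Q j i c j' i' c' :
  top P j i c -> top Q j' i' c' -> top (P * Q) (j + j') (i + i') (c * c').
Proof.
move=> [s1 s2 s3] [s4 s5 s6].
by split; rewrite ?coef_top ?size_mul_top // s3 s6.
Qed.

Lemma topMn P j i c n : top P j i c -> top (P *+ n) j i (c *+ n).
Proof.
move=> h; elim: n => [|n IHn]; last by rewrite !mulrS; apply: topD.
by split; rewrite ?mulr0n ?coef0 ?size_poly0.
Qed.

Lemma top0 j i : top 0 j i 0.
Proof. by split; rewrite ?coef0 ?size_poly0. Qed.

Lemma topX n : top ('X%:P ^+ n) 0 n 1.
Proof.
rewrite -rmorphXn; split; rewrite ?size_polyC_leq1 ?coefC ?size_polyXn //=.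
by rewrite coefXn eqxx.
Qed.

Lemma topY n : top ('X ^+ n) n 0 1.
Proof. by split; rewrite ?size_polyXn ?coefXn ?eqxx ?size_poly1 ?coefC. Qed.

(** The operator x d/dx is used in place of d/dx because it preserves exponents, so that no case
    distinction at [i = 0] is needed. *)
Lemma top_dx P j i c : top P j i c ->
  top ('X%:P * map_poly (@deriv A) P) j i (c *+ i).
Proof.
case=> s1 s2 s3; have cE k : ('X%:P * map_poly (@deriv A) P)`_k = 'X * (P`_k)^`().
  by rewrite coefCM coef_map_id0 ?deriv0.
split.
- rewrite mulrC; apply: leq_trans (size_polyMleq _ _) _.
  rewrite size_polyC polyX_eq0 addn1 /=.
  by apply: leq_trans (size_poly _ _) s1.
- rewrite cE; apply: leq_trans (size_polyMleq _ _) _; rewrite size_polyX addSn add1n.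
  have [->|p0] := eqVneq P`_j 0; first by rewrite deriv0 size_poly0.
  exact: leq_trans (lt_size_deriv p0) s2.
by rewrite cE coefXM; case: i s2 s3 => [|i] s2 s3; rewrite ?mulr0n //= coef_deriv s3.
Qed.

(** The degree in Y lost by the derivative is taken from [Q]; for [j = 0] the product is zero, as is
    the stated coefficient. *)
Lemma top_dy P j i c Q j' i' b : top P j i c -> top Q j'.+1 i' b ->
  top (P^`() * Q) (j + j') (i + i') (c * b *+ j).
Proof.
case: j => [|j] [s1 s2 s3] tQ.
  have -> : P^`() = 0 by rewrite (size1_polyC s1) derivC.
  by rewrite mul0r mulr0n; apply: top0.
rewrite -mulrnAl addSnnS; apply: topM => //; split; rewrite ?coef_deriv.
- by apply: leq_trans (size_deriv_le P) _; case: (size P) s1.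
- by apply: leq_trans s2; rewrite -mulr_natl -polyC_natr mul_polyC size_scale_leq.
by rewrite coefMn s3.
Qed.

End PolyTop.

(** * The coordinate ring over K[t] *)

(* What the proof uses of the localization of K[x, y, z] at
   t = y ^ l + x - x ^ d z: [br] is the Poisson bracket - Jac(t, ., .), and
   [m_free] says that t remains transcendental modulo x. *)
Record model (K : numClosedFieldType) (d l : nat) (U : comAlgType K) := Model {
  mx : U; my : U; mz : U; mt : U; mti : U;
  br : U -> U -> U;
  m_domain : forall a b : U, a * b = 0 -> a = 0 \/ b = 0;
  m_rel : mx ^+ d * mz = my ^+ l + mx - mt;
  m_ti : mt * mti = 1;
  m_gen : forall P : U -> Prop, (forall c : K, P c%:A) ->
    (forall a b, P a -> P b -> P (a + b)) ->
    (forall a b, P a -> P b -> P (a * b)) -> P mx -> P my -> P mz ->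
    forall u, exists k, P (mt ^+ k * u);
  m_x0 : mx <> 0;
  m_free : forall (a : {poly K}) (u : U), horner_alg mt a = mx * u -> a = 0;
  br_der : forall a, is_derivation (br a);
  br_alt : forall a b, br b a = - br a b;
  br_t : forall a, br a mt = 0;
  br_xy : br mx my = mx ^+ d;
  br_xz : br mx mz = l%:R * my ^+ l.-1;
  br_yz : br my mz = d%:R * mx ^+ d.-1 * mz - 1 }.

Section ModelTheory.
Variables (K : numClosedFieldType) (d l : nat) (U : comAlgType K).
Variable M : model d l U.
Implicit Types (u v : U) (D : U -> U).

Local Notation x := (mx M).
Local Notation y := (my M).
Local Notation z := (mz M).
Local Notation t := (mt M).
Local Notation ti := (mti M).
Local Notation "{ a , b }" := (br M a b).

(* [e0], [e1] and [e2] evaluate polynomials in t, in x over K[t], and in y over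
   K[t][x]; [e2] is injective and becomes onto after inverting x and t. *)
Definition e0 : {poly K} -> U := horner_alg t.
HB.instance Definition _ := GRing.RMorphism.on e0.

Fact e1_comm : commr_rmorph e0 x. Proof. by move=> ?; apply: mulrC. Qed.
Definition e1 : {poly {poly K}} -> U := horner_morph e1_comm.
HB.instance Definition _ := GRing.RMorphism.on e1.

Fact e2_comm : commr_rmorph e1 y. Proof. by move=> ?; apply: mulrC. Qed.
Definition e2 : {poly {poly {poly K}}} -> U := horner_morph e2_comm.
HB.instance Definition _ := GRing.RMorphism.on e2.

Lemma e0C c : e0 c%:P = c%:A. Proof. exact: horner_algC. Qed.
Lemma e0X : e0 'X = t. Proof. exact: horner_algX. Qed.
Lemma e1C c : e1 c%:P = e0 c. Proof. exact: horner_morphC. Qed.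
Lemma e1X : e1 'X = x. Proof. exact: horner_morphX. Qed.
Lemma e2C c : e2 c%:P = e1 c. Proof. exact: horner_morphC. Qed.
Lemma e2X : e2 'X = y. Proof. exact: horner_morphX. Qed.

Lemma e1D a b : e1 (a + b) = e1 a + e1 b. Proof. exact: rmorphD. Qed.
Lemma e1M a b : e1 (a * b) = e1 a * e1 b. Proof. exact: rmorphM. Qed.
Lemma e1Xn a n : e1 (a ^+ n) = e1 a ^+ n. Proof. exact: rmorphXn. Qed.
Lemma e0M a b : e0 (a * b) = e0 a * e0 b. Proof. exact: rmorphM. Qed.
Lemma e0Xn a n : e0 (a ^+ n) = e0 a ^+ n. Proof. exact: rmorphXn. Qed.
Lemma e0B a b : e0 (a - b) = e0 a - e0 b. Proof. exact: rmorphB. Qed.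
Lemma e1B a b : e1 (a - b) = e1 a - e1 b. Proof. exact: rmorphB. Qed.
Lemma e2B a b : e2 (a - b) = e2 a - e2 b. Proof. exact: rmorphB. Qed.
Lemma e2D a b : e2 (a + b) = e2 a + e2 b. Proof. exact: rmorphD. Qed.
Lemma e2M a b : e2 (a * b) = e2 a * e2 b. Proof. exact: rmorphM. Qed.
Lemma e2Xn a n : e2 (a ^+ n) = e2 a ^+ n. Proof. exact: rmorphXn. Qed.
Lemma e2_sum n (F : 'I_n -> {poly {poly {poly K}}}) :
  e2 (\sum_(i < n) F i) = \sum_(i < n) e2 (F i).
Proof. exact: rmorph_sum. Qed.
Lemma e2Mn a n : e2 (a *+ n) = e2 a *+ n. Proof. exact: rmorphMn. Qed.
Lemma e1Mn a n : e1 (a *+ n) = e1 a *+ n. Proof. exact: rmorphMn. Qed.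
Lemma mulU_neq0 u v : u <> 0 -> v <> 0 -> u * v <> 0.
Proof. by move=> u0 v0 /(m_domain M)[]. Qed.

Lemma expU_neq0 u n : u <> 0 -> u ^+ n <> 0.
Proof.
move=> u0; elim: n => [|n IHn]; last by rewrite exprS; apply: mulU_neq0.
by rewrite expr0; apply/eqP; rewrite oner_eq0.
Qed.

Lemma mulUI u v w : u <> 0 -> u * v = u * w -> v = w.
Proof.
move=> u0 /eqP; rewrite -subr_eq0 -mulrBr => /eqP /(m_domain M)[] //.
by move/eqP; rewrite subr_eq0 => /eqP.
Qed.

Lemma unit_neq0 u v : u * v = 1 -> u <> 0.
Proof. by move=> e u0; move/eqP: e; rewrite u0 mul0r eq_sym oner_eq0. Qed.

Lemma t_neq0 : t <> 0. Proof. exact: unit_neq0 (m_ti M). Qed.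
Lemma tn_neq0 n : t ^+ n <> 0. Proof. exact: expU_neq0 t_neq0. Qed.
Lemma xn_neq0 n : x ^+ n <> 0. Proof. exact: expU_neq0 (@m_x0 _ _ _ _ M). Qed.

Lemma scaleU_eq0 (c : K) u : c *: u = 0 -> c != 0 -> u = 0.
Proof. by move=> cu c0; rewrite -[u]scale1r -(mulVf c0) -scalerA cu scaler0. Qed.

Lemma natU_neq0 n : (n.+1%:R : U) <> 0.
Proof.
move=> e; have /(@scaleU_eq0 n.+1%:R (1 : U)) : n.+1%:R *: (1 : U) = 0.
  by rewrite scaler_nat.
by move=> h; move: (oner_neq0 U); rewrite h ?eqxx // pnatr_eq0.
Qed.

Lemma der_e0 D a : is_derivation D -> D t = 0 -> D (e0 a) = 0.
Proof.
move=> hD Dt; elim/poly_ind: a => [|a c IHa]; first by rewrite rmorph0 der0.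
rewrite rmorphD rmorphM /= e0X e0C (derD hD) (derM hD) IHa Dt der_scalar //.
by rewrite mul0r mulr0 !addr0.
Qed.

Lemma der_e1 D a : is_derivation D -> D t = 0 -> D (e1 a) = e1 a^`() * D x.
Proof.
move=> hD Dt; elim/poly_ind: a => [|a c IHa].
  by rewrite deriv0 rmorph0 der0 ?mul0r.
rewrite derivD derivM derivX derivC mulr1 addr0 !rmorphD !rmorphM /= e1X e1C.
by rewrite (derD hD) (derM hD) IHa der_e0 // addr0; ring.
Qed.

Definition dX (P : {poly {poly {poly K}}}) := map_poly (@deriv {poly K}) P.

Lemma der_e2 D P : is_derivation D -> D t = 0 ->
  D (e2 P) = e2 (dX P) * D x + e2 P^`() * D y.
Proof.
move=> hD Dt; elim/poly_ind: P => [|P c IHP].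
  by rewrite /dX map_poly0 deriv0 rmorph0 der0 ?mul0r ?addr0.
have -> : dX (P * 'X + c%:P) = dX P * 'X + (c^`())%:P.
  apply/polyP=> i; rewrite coefD coefMX coefC !coef_map_id0 ?deriv0 //.
  rewrite coefD coefMX coefC derivD.
  by case: i => [|i] /=; rewrite ?coef_map_id0 ?deriv0.
rewrite derivD derivM derivX derivC mulr1 addr0 !rmorphD !rmorphM /= e2X !e2C.
by rewrite (derD hD) (derM hD) IHP der_e1 //; ring.
Qed.

Lemma e0_inj a : e0 a = 0 -> a = 0.
Proof. by move=> h; apply: (@m_free _ _ _ _ M _ 0); rewrite mulr0. Qed.

Lemma deriv_eq0 (R : idomainType) (p : {poly R}) :
  (forall n, (n.+1%:R : R) != 0) -> p^`() = 0 -> p = (p`_0)%:P.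
Proof.
move=> ch0 p'0; apply/polyP=> -[|i]; rewrite coefC //=.
have /eqP : p^`()`_i = 0 by rewrite p'0 coef0.
by rewrite coef_deriv -mulr_natr mulf_eq0 (negbTE (ch0 _)) orbF => /eqP.
Qed.

Lemma charP1 n : (n.+1%:R : {poly K}) != 0.
Proof. by rewrite -polyC_natr polyC_eq0 pnatr_eq0. Qed.

Lemma charP2 n : (n.+1%:R : {poly {poly K}}) != 0.
Proof. by rewrite -polyC_natr polyC_eq0 charP1. Qed.

Lemma br_diag a : {a, a} = 0.
Proof.
have e : {a, a} + {a, a} = 0 by rewrite {1}br_alt addNr.
apply: (mulUI (@natU_neq0 1)); rewrite mulr0 -e; ring.
Qed.

Lemma br_yx : {y, x} = - x ^+ d. Proof. by rewrite br_alt br_xy. Qed.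

(** The bracket with y acts on K[t][x] as - x ^ d d/dx, so the kernel is stable under d/dx;
    induction on the degree reduces to K[t]. [e2_inj] does the same with the bracket with x. *)
Lemma e1_inj a : e1 a = 0 -> a = 0.
Proof.
have [n] := ubnP (size a); elim: n a => // n IHn a sa e1a.
have := der_e1 a (br_der M y) (br_t M y); rewrite e1a (der0 (br_der M y)) br_yx.
move=> /esym /(m_domain M)[/IHn h|/eqP]; last first.
  by rewrite oppr_eq0 => /eqP /xn_neq0.
have [->//|a0] := eqVneq a 0.
have a'0 : a^`() = 0 by apply: h; have := lt_size_deriv a0; lia.
move: e1a; rewrite (deriv_eq0 charP1 a'0) e1C => /e0_inj ->.
by rewrite polyC0.
Qed.

Lemma e2_inj a : e2 a = 0 -> a = 0.
Proof.
have [n] := ubnP (size a); elim: n a => // n IHn a sa e2a.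
have := der_e2 a (br_der M x) (br_t M x); rewrite e2a (der0 (br_der M x)) br_xy.
rewrite br_diag mulr0 add0r => /esym /(m_domain M)[/IHn h|/xn_neq0 //].
have [->//|a0] := eqVneq a 0.
have a'0 : a^`() = 0 by apply: h; have := lt_size_deriv a0; lia.
move: e2a; rewrite (deriv_eq0 charP2 a'0) e2C => /e1_inj ->.
by rewrite polyC0.
Qed.

Lemma e2_eq P Q : e2 P = e2 Q -> P = Q.
Proof. by move=> e; apply/eqP; rewrite -subr_eq0; apply/eqP/e2_inj; rewrite e2B e subrr. Qed.

(* The image of K[x, y, z]. *)
Record inB u : Prop := InB { inB_ind : forall P : U -> Prop,
  (forall c : K, P c%:A) -> (forall a b, P a -> P b -> P (a + b)) ->
  (forall a b, P a -> P b -> P (a * b)) -> P x -> P y -> P z -> P u }.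

Lemma inBD a b : inB a -> inB b -> inB (a + b).
Proof.
move=> [ha] [hb]; split=> P hc hD hM hx hy hz.
by apply: (hD); [exact: (ha P hc hD hM) | exact: (hb P hc hD hM)].
Qed.
Lemma inBM a b : inB a -> inB b -> inB (a * b).
Proof.
move=> [ha] [hb]; split=> P hc hD hM hx hy hz.
by apply: (hM); [exact: (ha P hc hD hM) | exact: (hb P hc hD hM)].
Qed.
Lemma inB_scalar (c : K) : inB c%:A. Proof. by split. Qed.
Lemma inB1 : inB 1. Proof. by rewrite -[1]scale1r; apply: inB_scalar. Qed.
Lemma inBx : inB x. Proof. by split. Qed.
Lemma inBy : inB y. Proof. by split. Qed.
Lemma inBz : inB z. Proof. by split. Qed.

Lemma inB_gen u : exists k, inB (t ^+ k * u).
Proof.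
apply: (m_gen (m := M)); last exact: inBz.
- exact: inB_scalar.
- exact: inBD.
- exact: inBM.
- exact: inBx.
exact: inBy.
Qed.

Lemma inBX a n : inB a -> inB (a ^+ n).
Proof.
move=> ha; elim: n => [|n IHn]; first by rewrite expr0; apply: inB1.
by rewrite exprS; apply: inBM.
Qed.
Lemma inBN a : inB a -> inB (- a).
Proof. by move=> ha; rewrite -scaleN1r -mulr_algl; apply: inBM => //; apply: inB_scalar. Qed.

Lemma t_def : t = y ^+ l + x - x ^+ d * z.
Proof. by rewrite m_rel; ring. Qed.

Lemma inBt : inB t.
Proof.
rewrite t_def; apply: inBD; last by apply/inBN/inBM/inBz/inBX/inBx.
by apply: inBD; [apply/inBX/inBy | apply: inBx].
Qed.

Lemma inBtn k u : inB u -> inB (t ^+ k * u).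
Proof. by move=> hu; apply: inBM => //; apply/inBX/inBt. Qed.

Lemma repB u : inB u -> exists N P, x ^+ N * u = e2 P.
Proof.
move=> [h]; apply: (h (fun u => exists N P, x ^+ N * u = e2 P)) =>
  [c|a b [N [P e]] [N' [Q e']]|a b [N [P e]] [N' [Q e']]|||].
- by exists 0%N, (c%:P%:P%:P); rewrite mul1r !e2C e1C e0C.
- exists (N + N')%N, ('X%:P ^+ N' * P + 'X%:P ^+ N * Q).
  rewrite rmorphD !rmorphM !rmorphXn /= e2C e1X -e -e' exprD; ring.
- exists (N + N')%N, (P * Q); rewrite rmorphM /= -e -e' exprD; ring.
- by exists 0%N, ('X%:P); rewrite mul1r e2C e1X.
- by exists 0%N, 'X; rewrite mul1r e2X.
exists d, ('X ^+ l + 'X%:P - 'X%:P%:P).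
by rewrite e2B rmorphD rmorphXn /= e2X !e2C e1X e1C e0X m_rel.
Qed.

Lemma rep u : exists N k P, x ^+ N * (t ^+ k * u) = e2 P.
Proof.
by have [k /repB[N [P e]]] := inB_gen u; exists N, k, P.
Qed.

Lemma e2_xn n : e2 ('X%:P ^+ n) = x ^+ n.
Proof. by rewrite rmorphXn /= e2C e1X. Qed.

Lemma e2_tn n : e2 ('X%:P%:P ^+ n) = t ^+ n.
Proof. by rewrite rmorphXn /= e2C e1C e0X. Qed.

(* A derivation killing t is determined by its values at x and y, because x is
   invertible in the localization and x^d z is a polynomial in x, y, t. *)
Lemma der_ext D1 D2 : is_derivation D1 -> is_derivation D2 ->
  D1 t = 0 -> D2 t = 0 -> forall a b, a * D1 x = b * D2 x -> a * D1 y = b * D2 y ->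
  forall u, a * D1 u = b * D2 u.
Proof.
move=> h1 h2 t1 t2 a b ex ey u; have [N [k [P e]]] := rep u.
have tX D : is_derivation D -> D t = 0 -> D (t ^+ k) = 0.
  by move=> hD Dt; rewrite derX // Dt mulr0.
have xX D : is_derivation D -> D (x ^+ N) = N%:R * x ^+ N.-1 * D x.
  by move=> hD; rewrite derX.
have step D : is_derivation D -> D t = 0 -> x ^+ N * (t ^+ k * D u) =
    e2 (dX P) * D x + e2 P^`() * D y - N%:R * x ^+ N.-1 * D x * (t ^+ k * u).
  move=> hD Dt; have := congr1 D e; rewrite der_e2 // !(derM hD) tX // xX //.
  by move=> <-; ring.
apply: (mulUI (xn_neq0 (n := N))); apply: (mulUI (tn_neq0 (n := k))).
transitivity (a * (x ^+ N * (t ^+ k * D1 u))); first by ring.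
transitivity (b * (x ^+ N * (t ^+ k * D2 u))); last by ring.
rewrite !step //.
transitivity (e2 (dX P) * (a * D1 x) + e2 P^`() * (a * D1 y) -
   N%:R * x ^+ N.-1 * (a * D1 x) * (t ^+ k * u)); first by ring.
by rewrite ex ey; ring.
Qed.

End ModelTheory.

(** * Degree in y against the pole in x *)

Section Filtration.
Variables (K : numClosedFieldType) (d l : nat) (U : comAlgType K).
Variable M : model d l U.
Hypothesis l_gt0 : (0 < l)%N.

Local Notation x := (mx M).
Local Notation y := (my M).
Local Notation z := (mz M).
Local Notation t := (mt M).
Local Notation e2 := (e2 M).
Local Notation R2 := {poly {poly {poly K}}}.

Fact e3_comm : commr_rmorph e2 z. Proof. by move=> ?; apply: mulrC. Qed.
Definition e3 : {poly R2} -> U := horner_morph e3_comm.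
HB.instance Definition _ := GRing.RMorphism.on e3.

Lemma e3C c : e3 c%:P = e2 c. Proof. exact: horner_morphC. Qed.
Lemma e3X : e3 'X = z. Proof. exact: horner_morphX. Qed.

Lemma e3B a b : e3 (a - b) = e3 a - e3 b. Proof. exact: rmorphB. Qed.
Lemma e3D a b : e3 (a + b) = e3 a + e3 b. Proof. exact: rmorphD. Qed.
Lemma e3M a b : e3 (a * b) = e3 a * e3 b. Proof. exact: rmorphM. Qed.
Lemma e3Xn a n : e3 (a ^+ n) = e3 a ^+ n. Proof. exact: rmorphXn. Qed.

Lemma e3_surj u : inB M u -> exists C, u = e3 C.
Proof.
case=> h; apply: (h (fun u => exists C, u = e3 C)) => [c|a b [C ->] [C' ->]|a b [C ->] [C' ->]|||].
- by exists c%:P%:P%:P%:P; rewrite e3C e2C e1C e0C.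
- by exists (C + C'); rewrite rmorphD.
- by exists (C * C'); rewrite rmorphM.
- by exists 'X%:P%:P; rewrite e3C e2C e1X.
- by exists 'X%:P; rewrite e3C e2X.
by exists 'X; rewrite e3X.
Qed.

Definition relp : R2 := 'X ^+ l + 'X%:P - 'X%:P%:P.

Lemma e2_relp : e2 relp = x ^+ d * z.
Proof. by rewrite /relp e2B e2D e2Xn e2X !e2C e1X e1C e0X m_rel. Qed.

Lemma size_relpX n : (size (relp ^+ n)%R <= (l * n).+1)%N /\ (relp ^+ n)`_(l * n) = 1.
Proof.
have s1 : (size relp <= l.+1)%N.
  rewrite /relp -addrA; apply: leq_trans (size_polyD _ _) _.
  rewrite size_polyXn geq_max leqnn -rmorphB /=.
  exact: leq_trans (size_polyC_leq1 _) _.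
have c1 : relp`_l = 1.
  rewrite /relp coefB coefD coefXn eqxx !coefC.
  by case: l l_gt0 => //= n' _; rewrite addr0 subr0.
elim: n => [|n [IH1 IH2]].
  by rewrite expr0 muln0 size_poly1 coefC eqxx.
by rewrite exprS mulnS size_mul_top // coef_top // IH2 c1 mulr1.
Qed.

Lemma x_relp n k : (k <= n)%N -> x ^+ (d * n) * z ^+ k = e2 ('X%:P ^+ (d * (n - k)) * relp ^+ k).
Proof.
move=> kn; rewrite e2M e2_xn e2Xn e2_relp.
by rewrite exprMn mulrA -exprM -exprD -mulnDr subnK.
Qed.

Lemma clear_denom (C : {poly R2}) n : (size C <= n.+1)%N ->
  x ^+ (d * n) * e3 C =
  e2 (\sum_(k < n.+1) C`_k * ('X%:P ^+ (d * (n - k)) * relp ^+ k)).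
Proof.
move=> sC; rewrite [in LHS](_ : C = \sum_(k < n.+1) (C`_k)%:P * 'X ^+ k); last first.
  rewrite -[LHS](coefK C) poly_def.
  rewrite (big_ord_widen n.+1 (fun i => C`_i *: 'X^i)) // big_mkcond /=.
  apply: eq_bigr => i _; case: ltnP => [|h]; rewrite ?mul_polyC //.
  by rewrite nth_default // scale0r.
rewrite rmorph_sum /= e2_sum mulr_sumr; apply: eq_bigr => k _.
rewrite e2M.
rewrite -(@x_relp n k); last by rewrite -ltnS.
rewrite rmorphM.
rewrite rmorphXn /=.
rewrite e3C.
rewrite e3X.
by ring.
Qed.

Lemma coef_XC_mul (P : R2) n j : ('X%:P ^+ n * P)`_j = 'X ^+ n * P`_j.
Proof. by rewrite -rmorphXn coefCM. Qed.

Lemma clear_denom_coef (C : {poly R2}) n N P j : (size C <= n.+1)%N ->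
  x ^+ N * e3 C = e2 P ->
  'X ^+ (d * n) * P`_j =
  'X ^+ N * \sum_(k < n.+1) 'X ^+ (d * (n - k)) * (C`_k * relp ^+ k)`_j.
Proof.
move=> sC e; have e' : 'X%:P ^+ (d * n) * P = 'X%:P ^+ N *
    \sum_(k < n.+1) 'X%:P ^+ (d * (n - k)) * (C`_k * relp ^+ k).
  apply: (e2_eq (M := M)); rewrite !e2M !e2_xn -e.
  rewrite mulrCA clear_denom // !e2_sum; congr (_ * _).
  by apply: eq_bigr => k _; rewrite !e2M; ring.
rewrite -coef_XC_mul e' coef_XC_mul coef_sum; congr (_ * _).
by apply: eq_bigr => k _; rewrite coef_XC_mul.
Qed.

Lemma polyX_neq0 (A : idomainType) n : ('X ^+ n : {poly A}) != 0.
Proof. by rewrite expf_neq0 // polyX_eq0. Qed.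

Lemma size_XC_mul (P : R2) n : size ('X%:P ^+ n * P) = size P.
Proof. by rewrite -rmorphXn size_Cmul // polyX_neq0. Qed.

(* [e3 C] then has degree less than J in y, once z is replaced by
   (y ^ l + x - t) / x ^ d. *)
Definition fil (J : nat) (C : {poly R2}) :=
  forall k, (size (C`_k)%R <= J - l * k)%N.

(* If the terms of y-degree J cancel, the leading coefficient of the highest power
   of z is divisible by x ^ d, so the relation x ^ d z = y ^ l + x - t lowers
   the degree in z. *)
Lemma fil_lower J C N P : fil J.+1 C -> x ^+ N * e3 C = e2 P ->
  (size P <= J)%N -> exists2 C', e3 C' = e3 C & fil J C'.
Proof.
have [n] := ubnP (size C); elim: n C N P => // n IHn C N P; rewrite ltnS.
case: n IHn => [_|n IHn] sC fC e sP.
  have -> : C = 0 by apply/eqP; rewrite -size_poly_eq0 -leqn0.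
  by exists 0 => // k; rewrite coef0 size_poly0.
case: n sC IHn => [sC _|m sC IHn].
  exists C => // k; have CE := size1_polyC sC; move: e.
  rewrite CE e3C coefC -(e2_xn M) -e2M => /(@e2_eq _ _ _ _ M) eP.
  by case: k => [|k] /=; rewrite ?size_poly0 // muln0 subn0 -(size_XC_mul _ N) eP.
have [big|small] := ltnP J (l * m.+1).
  apply: (IHn C N P) => //; rewrite ltnS.
  apply/leq_sizeP => j; rewrite leq_eqVlt => /predU1P[<-|]; last first.
    by move=> h; rewrite nth_default // (leq_trans sC).
  apply/eqP; rewrite -size_poly_eq0 -leqn0 (leq_trans (fC _)) // leqn0.
  by rewrite subn_eq0.
set J' := (J - l * m.+1)%N.
set c := C`_m.+1; set g := c`_J'.
have sc : (size c <= J'.+1)%N by apply: leq_trans (fC _) _; rewrite subSn.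
have JE : J = (J' + l * m.+1)%N by rewrite subnK.
have [sR cR] := size_relpX m.+1.
(* Compare the coefficients of y ^ J: the one of [P] vanishes, the top power of z contributes [g],
   and every lower power of z carries a factor x ^ d. *)
have [g' gE] : exists g', g = 'X ^+ d * g'.
  have := clear_denom_coef J sC e; rewrite [P`_J]nth_default // mulr0.
  move/esym/eqP; rewrite mulf_eq0 (negbTE (polyX_neq0 _ _)) /= big_ord_recr /=.
  rewrite subnn muln0 expr0 mul1r {2}JE coef_top // cR mulr1 -/c -/g.
  rewrite addrC addr_eq0 => /eqP ->.
  exists (- \sum_(k < m.+1) 'X ^+ (d * (m - k)) * (C`_k * relp ^+ k)`_J).
  rewrite mulrN mulr_sumr; congr (- _); apply: eq_bigr => k _.
  by rewrite mulrA -exprD -mulnS subSn // -ltnS.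
set c' := c - g%:P * 'X^J'.
have sc' : (size c' <= J')%N.
  apply/leq_sizeP => j; rewrite leq_eqVlt /c' coefB coefCM coefXn => /predU1P[<-|h].
    by rewrite eqxx mulr1 subrr.
  by rewrite nth_default ?(leq_trans sc) // gtn_eqF // mulr0 subrr.
(* The monomial g y ^ J' z ^ (m + 1) is rewritten as g' y ^ J' (y ^ l + x - t) z ^ m; [c'] keeps the
   rest of the top coefficient. *)
set C1 := \poly_(k < m.+1) (C`_k + (g'%:P * 'X^J' * relp) *+ (k == m)).
have e3C1 : e3 C1 + e2 c' * z ^+ m.+1 = e3 C.
  have -> : C = C1 + c'%:P * 'X ^+ m.+1 + (g%:P * 'X^J')%:P * 'X ^+ m.+1
                - (g'%:P * 'X^J' * relp)%:P * 'X^m.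
    apply/polyP => k; rewrite coefB !coefD coef_poly !coefCM !coefXn /c'.
    case: (ltngtP k m.+1) => [h|h|->].
    - by case: eqP => _; rewrite ?mulr1n ?mulr0n; ring.
    - by rewrite nth_default ?(leq_trans sC) // gtn_eqF ?(ltnW h) //= !mulr0n !mulr0; ring.
    by rewrite gtn_eqF // -/c /= mulr0n mulr1n; ring.
  rewrite e3B !e3D !e3M !e3Xn !e3C e3X.
  rewrite gE !e2M e2_relp polyCM polyC_exp e2M e2_xn exprS; ring.
clearbody c'.
have [C2 e3C2 fC2] : exists2 C', e3 C' = e3 C1 & fil J C'.
  apply: (IHn C1 (N + d * m.+1)%N ('X%:P ^+ (d * m.+1) * P - 'X%:P ^+ N * (c' * relp ^+ m.+1))).
  - by rewrite ltnS size_poly.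
  - move=> k; rewrite coef_poly; case: ltnP => hk; last by rewrite size_poly0.
    apply: leq_trans (size_polyD _ _) _; rewrite geq_max fC /=.
    case: eqP => [->|]; rewrite ?mulr0n ?size_poly0 // mulr1n.
    have := @size_mul_top _ (g'%:P * 'X^J') (relp ^+ 1) J' (l * 1).
    rewrite expr1 => /(_ _ _) h; apply: leq_trans (h _ _) _; last 1 first.
    + by move: small; rewrite /J' mulnS; lia.
    + apply: leq_trans (size_polyMleq _ _) _; rewrite size_polyXn addnS /=.
      by rewrite -add1n leq_add2r size_polyC_leq1.
    by have [] := size_relpX 1; rewrite expr1.
  - rewrite e2B !e2M !e2_xn -e -e3C1.
    rewrite e2Xn e2_relp exprD exprMn -exprM; ring.
  apply: leq_trans (size_polyD _ _) _; rewrite size_polyN !size_XC_mul geq_max sP /=.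
  apply: leq_trans (size_polyMleq _ _) _; move: (leq_add sc' sR).
  by rewrite addnS -JE; case: (_ + _)%N.
exists (C2 + c'%:P * 'X ^+ m.+1).
  by rewrite e3D e3M e3Xn e3C e3X e3C2.
move=> k; rewrite coefD coefCM coefXn; apply: leq_trans (size_polyD _ _) _.
rewrite geq_max fC2 /=; case: eqP => [->|_]; last by rewrite mulr0 size_poly0.
by rewrite mulr1.
Qed.

(** Any expression in x, y, z satisfies [fil] for some large bound, and [fil_lower] brings the bound
    down to the true degree in y. *)
Lemma filP u N P : inB M u -> x ^+ N * u = e2 P ->
  exists2 C, e3 C = u & fil (size P) C.
Proof.
move=> /e3_surj[C ->] e.
have [J fC] : exists J, fil J C.
  exists (\sum_(k < size C) (size (C`_k)%R + l * k))%N => k.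
  have [h|h] := ltnP k (size C); last by rewrite nth_default // size_poly0.
  rewrite (bigD1 (Ordinal h)) //= ; lia.
elim: J C fC e => [|J IHJ] C fC e.
  by exists C => // k; apply: leq_trans (fC k) _; rewrite sub0n.
have [h|h] := leqP (size P) J; last first.
  by exists C => // k; apply: leq_trans (fC k) _; apply: leq_sub2r.
have [C' eC' fC'] := fil_lower fC e h.
by rewrite -eC'; apply: IHJ; rewrite ?eC'.
Qed.

(** As z counts for degree l in y, a degree below l leaves no room for z, the only source of
    negative powers of x. *)
Lemma low_degree u N P : inB M u -> x ^+ N * u = e2 P -> (size P <= l)%N ->
  exists Q, u = e2 Q.
Proof.
move=> hu e sP; have [C <- fC] := filP hu e.
exists C`_0; rewrite -e3C; congr e3; apply/polyP => -[|k]; rewrite coefC //=.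
apply/eqP; rewrite -size_poly_eq0 -leqn0; apply: leq_trans (fC _) _.
by rewrite mulnS; lia.
Qed.

(** In degree j only the powers z ^ k with k <= j / l occur, and z ^ k brings a denominator of at
    most x ^ (d k). *)
Lemma lead_bound u N P j i : inB M u -> x ^+ N * u = e2 P -> (size P <= j.+1)%N ->
  P`_j`_i != 0 -> (N <= i + d * (j %/ l))%N.
Proof.
move=> hu e sP; have [C CE fC] := filP hu e; rewrite -CE in e.
have := clear_denom_coef j (leqnSn (size C)) e; set n := size C.
set S := \sum_(_ < _) _.
have [S' SE] : exists S', S = 'X ^+ (d * (n - j %/ l)) * S'.
  exists (\sum_(k < n.+1) 'X ^+ (d * (n - k) - d * (n - j %/ l)) * (C`_k * relp ^+ k)`_j).
  rewrite mulr_sumr; apply: eq_bigr => k _.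
  have [hk|hk] := leqP k (j %/ l); last first.
    rewrite (_ : C`_k = 0) ?mul0r ?coef0 ?mulr0 //; apply/eqP.
    rewrite -size_poly_eq0 -leqn0; apply: leq_trans (fC _) _.
    rewrite leqn0 subn_eq0 (leq_trans sP) //.
    by move: hk; rewrite ltn_divLR // mulnC.
  by rewrite mulrA -exprD subnKC // leq_mul // leq_sub2l.
rewrite SE mulrA -exprD => h; apply: contraR; rewrite -ltnNge => lt.
have /(congr1 (fun p : {poly {poly K}} => p`_(d * n + i))) := h.
rewrite !coefXnM ltnNge leq_addr /= addKn => ->.
rewrite ifT //; move: lt; rewrite mulnBr; lia.
Qed.

End Filtration.

(** * Locally nilpotent derivations for d, l >= 2 *)

(* The numerical contradiction behind the rigidity of [x] when [2 <= d] and
   [2 <= l]: a nonzero value [D x] would force the leading exponent [(e1, e2)]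
   of [D] to satisfy these relations. *)
Lemma no_exponent (d l a b c e2 : nat) (e1 : int) :
  (2 <= d)%N -> (2 <= l)%N -> e1 * a%:Z + e2%:Z * b%:Z = - 1 ->
  (l * b = d * a + c)%N ->
  ((0 < a)%N -> 0 <= e1 + 1 + (d * (e2 %/ l))%N%:Z) ->
  ((0 < b)%N -> 0 <= e1 + (d * (e2.+1 %/ l))%N%:Z) -> False.
Proof.
move=> d2 l2 E lb h1 h2.
have a0 : (0 < a)%N by case: a E lb h1 => // E; nia.
have b0 : (0 < b)%N by case: b lb {E h2} => // ; nia.
move/(_ a0): h1; move/(_ b0): h2.
set q := (e2 %/ l)%N; set r := (e2 %% l)%N.
have e2E : e2 = (q * l + r)%N by apply: divn_eq.
have rl : (r < l)%N by rewrite ltn_mod; lia.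
have qE : (e2.+1 %/ l = q + (r.+1 == l))%N.
  rewrite e2E -addnS divnMDl; last by lia.
  case: eqP => [->|ne]; first by rewrite divnn; lia.
  by rewrite divn_small //; lia.
rewrite qE => h2 h1.
set i := e1 + 1 + (d * q)%N%:Z in h1.
(* The three terms on the left are nonnegative and the right side is below [a]; hence [i = 0], and
   then [h2] forces r = l - 1. *)
have F : a%:Z * i + c%:Z * q%:Z + b%:Z * r%:Z = a%:Z - 1.
  have L : l%:Z * b%:Z = d%:Z * a%:Z + c%:Z by rewrite -!PoszM -PoszD lb.
  transitivity (e1 * a%:Z + e2%:Z * b%:Z + a%:Z
     - q%:Z * (l%:Z * b%:Z - (d%:Z * a%:Z + c%:Z))).
    by rewrite /i e2E !PoszD !PoszM; ring.
  by rewrite E L; ring.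
have cq : 0 <= c%:Z * q%:Z by rewrite -PoszM.
have br : 0 <= b%:Z * r%:Z by rewrite -PoszM.
have i0 : i = 0.
  have [i1|i1] := ltrP i 1; first by lia.
  have : a%:Z * 1 <= a%:Z * i by rewrite ler_pM2l.
  by rewrite mulr1; lia.
have r1 : r.+1 = l.
  case: eqP h2 => // _; rewrite addn0 => h2.
  by move: i0; rewrite /i; lia.
(* Now r = l - 1 >= 1, so l b = b r + b <= 2 b r < 2 a <= d a, against l b = d a + c. *)
have A1 : (b * r < a)%N by move: F; rewrite i0 mulr0 add0r -!PoszM; lia.
have A2 : (2 * a <= d * a)%N by rewrite leq_mul2r d2 orbT.
have A3 : (b <= b * r)%N by rewrite leq_pmulr // -ltnS r1.
by move: lb; rewrite -r1 mulSn mulnC; lia.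
Qed.

Section Rigidity.
Variables (K : numClosedFieldType) (d l : nat) (U : comAlgType K).
Variable M : model d l U.
Hypotheses (d_ge2 : (2 <= d)%N) (l_ge2 : (2 <= l)%N).

Local Notation x := (mx M).
Local Notation y := (my M).
Local Notation z := (mz M).
Local Notation t := (mt M).
Local Notation e2 := (e2 M).
Local Notation R2 := {poly {poly {poly K}}}.

(* [c x^v y^j] is the leading term of [u], with [c] a polynomial in t, possibly
   zero. *)
Definition lead (u : U) (j : nat) (v : int) (c : {poly K}) : Prop :=
  exists N i P, [/\ x ^+ N * u = e2 P, v = i%:Z - N%:Z & top P j i c].

Lemma lead0 u j v c : lead u j v c -> u = 0 -> c = 0.
Proof.
move=> [N [i [P [e _ [_ _ <-]]]]] u0; move: e; rewrite u0 mulr0 => /esym.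
by move/(@e2_inj _ _ _ _ M) ->; rewrite !coef0.
Qed.

Lemma leadx : lead x 0 1 1.
Proof.
exists 0%N, 1%N, ('X%:P ^+ 1); split=> //; last exact: topX.
by rewrite mul1r expr1 e2C e1X.
Qed.

Lemma leady : lead y 1 0 1.
Proof.
exists 0%N, 0%N, ('X ^+ 1); split=> //; last exact: topY.
by rewrite mul1r expr1 e2X.
Qed.

Lemma leadz : lead z l (- d%:Z) 1.
Proof.
exists d, 0%N, (relp K l); split; rewrite ?sub0r ?e2_relp //.
have l0 : (0 < l)%N by apply: ltnW.
have [s c] := size_relpX K l0 1; rewrite expr1 muln1 in s c.
by split=> //; rewrite c ?size_poly1 // coefC.
Qed.

Lemma lead_inB u j v c : inB M u -> lead u j v c -> c != 0 ->
  0 <= v + (d * (j %/ l))%N%:Z.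
Proof.
move=> hu [N [i [P [e -> [sP _ cE]]]]] c0; rewrite -cE in c0.
have := lead_bound (ltnW l_ge2) hu e sP c0; lia.
Qed.

Section Derivation.
Variable D : U -> U.
Hypotheses (hD : is_derivation D) (Dt : D t = 0).
Variables (Q : nat) (A B : R2).
Hypotheses (eA : x ^+ Q * D x = e2 A) (eB : x ^+ Q * D y = e2 B).
Variables (e f : nat) (al be : {poly K}).
Hypotheses (tA : top A e f.+1 al) (tB : top B e.+1 f be).

(** On leading terms [D] acts as x ^ (f - Q) y ^ e times the Euler field al x d/dx + be y d/dy. *)
Lemma lead_der u j v c : lead u j v c ->
  lead (D u) (j + e) (v + (f%:Z - Q%:Z)) ((al *~ v + be *+ j) * c).
Proof.
move=> [N [i [P [eP -> tP]]]].
exists (N + Q).+1, (i + f.+1)%N,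
  ('X%:P * dX P * A + P^`() * ('X%:P ^+ 1 * B) - P * A *+ N); split.
- have := congr1 D eP; rewrite der_e2 // (derM hD) derX // => /(congr1 (fun w => x * x ^+ Q * w)).
  rewrite expr1 e2B -[P * A *+ N]mulr_natr !e2D !e2M -eA -eB !e2C !e1X -eP.
  rewrite (_ : e2 N%:R = N%:R); last first.
    by elim: N {eP} => [|N IH]; [apply: rmorph0|];
       rewrite !mulrS e2D IH; congr (_ + _); apply: rmorph1.
  move=> h.
  have xN : x * (N%:R * x ^+ N.-1) = N%:R * x ^+ N.
    by case: N {eP h} => [|N] /=; rewrite ?mul0r ?mulr0 // exprS; ring.
  have -> : x ^+ (N + Q).+1 * D u = x * x ^+ Q * (N%:R * x ^+ N.-1 * D x * u + x ^+ N * D u)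
      - (x * (N%:R * x ^+ N.-1)) * u * (x ^+ Q * D x).
    by rewrite exprS exprD; ring.
  by rewrite h xN; ring.
- lia.
have tB' := topM (topX _ 1) tB; rewrite add0n add1n mul1r in tB'.
have t1 := topM (top_dx tP) tA.
have t2 := top_dy tP tB'.
have t3 := topMn N (topM tP tA).
rewrite (_ : _ * c = c *+ i * al + c * be *+ j - c * al *+ N).
  exact: topD (topD t1 t2) (topN t3).
ring.
Qed.

(** Each iteration multiplies the leading coefficient by the weight at the current exponent; in a
    domain, nilpotency makes one of these weights vanish. *)
Lemma lead_vanish u j v c : lead u j v c -> c != 0 ->
  (exists n, iter n D u = 0) ->
  exists k : nat, al *~ (v + k%:Z * (f%:Z - Q%:Z)) + be *+ (j + k * e) = 0.
Proof.
move=> hu c0 [n un].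
have step k : lead (iter k D u) (j + k * e) (v + k%:Z * (f%:Z - Q%:Z))
    (c * \prod_(i < k) (al *~ (v + i%:Z * (f%:Z - Q%:Z)) + be *+ (j + i * e))).
  elim: k => [|k IHk]; first by rewrite big_ord0 mulr1 mul0n addn0 mul0r addr0.
  have := lead_der IHk; rewrite iterS big_ord_recr /=.
  congr (lead _ _ _ _); [lia | lia | ring].
have /eqP := lead0 (step n) un; rewrite mulf_eq0 (negbTE c0) /= prodf_seq_eq0.
by case/hasP => k _ /= /eqP h; exists k.
Qed.

Hypothesis D_nil : loc_nilpotent D.
Hypotheses (inBx : inB M (D x)) (inBy : inB M (D y)).

(** One application of [D] changes the weight by s = al e1 + be e. Its vanishing on the orbits of x,
    y and z after k1, k2 and k3 steps gives al = - k1 s, be = - k2 s and l be - d al = - k3 s, and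
    dividing by s leads to the system excluded by [no_exponent]. *)
Lemma no_lead : ~ (al != 0 \/ be != 0).
Proof.
set e1 := f%:Z - Q%:Z.
have [k1 E1] := lead_vanish leadx (oner_neq0 _) (D_nil x).
have [k2 E2] := lead_vanish leady (oner_neq0 _) (D_nil y).
have [k3 E3] := lead_vanish leadz (oner_neq0 _) (D_nil z).
rewrite -/e1 in E1 E2 E3.
pose s := al *~ e1 + be *+ e.
have F1 : al = - (s *+ k1).
  apply/eqP; rewrite -addr_eq0; apply/eqP; rewrite -[RHS]E1 /s.
  by ring.
have F2 : be = - (s *+ k2).
  apply/eqP; rewrite -addr_eq0; apply/eqP; rewrite -[RHS]E2 /s.
  by ring.
have F3 : be *+ l - al *+ d + s *+ k3 = 0.
  rewrite -[RHS]E3 /s.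
  by ring.
move=> nz; have s0 : s != 0.
  by apply/eqP => s0; move: nz; rewrite F1 F2 s0 !mul0rn oppr0 eqxx; case.
have zinj (n : int) : s *~ n = 0 -> n = 0.
  rewrite -mulrzr => /eqP; rewrite mulf_eq0 (negbTE s0) /=.
  by rewrite -(rmorph_int (@polyC K)) polyC_eq0 intr_eq0 => /eqP.
apply: (@no_exponent d l k1 k2 k3 e e1) => //.
- apply/eqP; rewrite -subr_eq0 opprK; apply/eqP/zinj.
  transitivity (s - (- (s *+ k1) *~ e1 + - (s *+ k2) *+ e)).
    by ring.
  by rewrite -F1 -F2 subrr.
- suff : (l * k2)%N%:Z - (d * k1 + k3)%N%:Z = 0 by lia.
  apply: zinj; apply: oppr_inj; rewrite oppr0 -[RHS]F3 F1 F2.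
  by ring.
(* The two remaining inequalities are the pole bound applied to [D x] and [D y], whose leading
   coefficients [al] and [be] are nonzero when k1 and k2 are positive. *)
- move=> k10; have := lead_der leadx; rewrite mulr1 mulr1z mulr0n addr0 add0n.
  move=> /(lead_inB inBx); rewrite [1 + (_ - _)]addrC.
  by apply; rewrite F1 oppr_eq0 -mulr_natr mulf_neq0 // -polyC_natr polyC_eq0 pnatr_eq0 -lt0n.
move=> k20; have := lead_der leady; rewrite mulr1 mulr0z mulr1n !add0r add1n.
move=> /(lead_inB inBy); apply.
by rewrite F2 oppr_eq0 -mulr_natr mulf_neq0 // -polyC_natr polyC_eq0 pnatr_eq0 -lt0n.
Qed.

End Derivation.

Lemma lnd_kills_x_inB D : is_derivation D -> D t = 0 -> loc_nilpotent D ->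
  inB M (D x) -> inB M (D y) -> D x = 0.
Proof.
move=> hD Dt nil hx hy.
have [N [P eP]] := repB hx; have [N' [P' eP']] := repB hy.
(* The two denominators are made equal, and one more factor x gives every nonzero coefficient of [A]
   and [B] positive degree in x, so that the x-degree of [a] can be written as [f.+1]. *)
pose A : R2 := 'X%:P ^+ N'.+1 * P; pose B : R2 := 'X%:P ^+ N.+1 * P'.
have eA : x ^+ (N + N').+1 * D x = e2 A.
  by rewrite e2M e2_xn -eP !exprS exprD; ring.
have eB : x ^+ (N + N').+1 * D y = e2 B.
  by rewrite e2M e2_xn -eP' !exprS exprD; ring.
have big (R : R2) n j : ('X%:P ^+ n.+1 * R)`_j != 0 -> (1 < size (('X%:P ^+ n.+1 * R)`_j)%R)%N.
  rewrite coef_XC_mul mulf_eq0 negb_or => /andP[_ Rj].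
  by rewrite mulrC size_mulXn // addSn ltnS ltn_addl // size_poly_gt0.
have [A0|A0] := eqVneq A 0.
  by apply: (mulUI M (xn_neq0 (M := M) (n := (N + N').+1))); rewrite eA A0 mulr0; apply: rmorph0.
exfalso.
(* [D] raises the degree in y by at most that of [A], or that of [B] minus one, since y itself has
   degree 1; [f] below does the same for x with the roles exchanged. *)
pose e := maxn (size A).-1 (size B).-2.
have sA : (size A <= e.+1)%N by rewrite /e; lia.
have sB : (size B <= e.+2)%N by rewrite /e; lia.
have nz : (A`_e != 0) \/ (B`_e.+1 != 0).
  have [h|h] := leqP (size B).-2 (size A).-1.
    by left; rewrite /e (maxn_idPl h) -lead_coefE lead_coef_eq0.
  right; rewrite /e (maxn_idPr (ltnW h)).
  have -> : ((size B).-2.+1 = (size B).-1)%N by lia.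
  by rewrite -lead_coefE lead_coef_eq0 -size_poly_gt0; lia.
pose a := A`_e; pose b := B`_e.+1.
have a1 : a != 0 -> (1 < size a)%N by apply: big.
have b1 : b != 0 -> (1 < size b)%N by apply: big.
pose f := maxn (size b).-1 (size a).-2.
have sa : (size a <= f.+2)%N by rewrite /f; lia.
have sb : (size b <= f.+1)%N by rewrite /f; lia.
have tA : top A e f.+1 a`_f.+1 by split.
have tB : top B e.+1 f b`_f by split.
apply: (no_lead hD Dt eA eB tA tB nil hx hy).
have [h|h] := leqP (size a).-2 (size b).-1.
  have [b0|b0] := eqVneq b 0; last first.
    by right; rewrite /f (maxn_idPl h) -lead_coefE lead_coef_eq0.
  have a0 : a != 0 by case: nz; rewrite -/a -/b // b0 eqxx.
  left; rewrite (_ : f.+1 = (size a).-1); first by rewrite -lead_coefE lead_coef_eq0.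
  by move: (a1 a0) h; rewrite /f b0 size_poly0; lia.
left; rewrite (_ : f.+1 = (size a).-1); last by rewrite /f; lia.
have sa0 : (0 < size a)%N by move: h; case: (size a).
by rewrite -lead_coefE lead_coef_eq0 -size_poly_gt0.
Qed.

(** Since t is a constant of [D], multiplying [D] by a power of t keeps it locally nilpotent and
    moves [D x] and [D y] into the image of K[x, y, z]. *)
Lemma lnd_kills_x D : is_derivation D -> D t = 0 -> loc_nilpotent D -> D x = 0.
Proof.
move=> hD Dt nil.
have [k hk] := inB_gen M (D x); have [m hm] := inB_gen M (D y).
pose D' u := t ^+ (k + m) * D u.
have hD' : is_derivation D'.
  split=> [a b|a b|c a]; rewrite /D'.
  - by rewrite (derD hD) mulrDr.
  - by rewrite (derM hD); ring.
  by rewrite (derZ hD) scalerAr.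
have D't : D' t = 0 by rewrite /D' Dt mulr0.
have Dtn : D (t ^+ (k + m)) = 0 by rewrite derX // Dt mulr0.
have nil' : loc_nilpotent D'.
  move=> u; have [n un] := nil u; exists n.
  suff -> : iter n D' u = (t ^+ (k + m)) ^+ n * iter n D u by rewrite un mulr0.
  elim: n {un} => [|n IHn]; first by rewrite mul1r.
  by rewrite !iterS IHn /D' (derM hD) derX // Dtn mulr0 mul0r add0r mulrA -exprS.
have : D' x = 0.
  apply: lnd_kills_x_inB => //; rewrite /D' exprD.
    by rewrite mulrAC mulrC; apply: inBtn.
  by rewrite -mulrA; apply: inBtn.
by move/(m_domain M) => [/(tn_neq0 (M := M))|].
Qed.

End Rigidity.

(** * Units and the kernel of the bracket with x *)

Lemma size_mulC_le1 (A : idomainType) (p q : {poly A}) a :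
  a != 0 -> p * q = a%:P -> (size p <= 1)%N.
Proof.
move=> a0 e; have pq0 : p * q != 0 by rewrite e polyC_eq0.
have p0 : p != 0 by apply: contraNneq pq0 => ->; rewrite mul0r.
have q0 : q != 0 by apply: contraNneq pq0 => ->; rewrite mulr0.
have := size_mul p0 q0; rewrite e size_polyC a0.
by move: p0 q0; rewrite -!size_poly_gt0; case: (size p) => // m; case: (size q) => // n; lia.
Qed.

Lemma monomial_factor (A : fieldType) (p q : {poly A}) n :
  p * q = 'X^n -> exists a m, a != 0 /\ p = a *: 'X^m.
Proof.
elim: n p q => [|n IHn] p q e.
  have sp : (size p <= 1)%N by apply: (@size_mulC_le1 _ _ q 1); rewrite ?oner_neq0.
  exists p`_0, 0%N; rewrite alg_polyC -size1_polyC //; split=> //.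
  apply: contraNneq (oner_neq0 {poly A}) => p0.
  by rewrite -[1]e (size1_polyC sp) p0 mul0r.
have := congr1 (fun r : {poly A} => r.[0]) e.
rewrite hornerM hornerXn expr0n /= => /eqP; rewrite mulf_eq0.
have factor0 (r : {poly A}) : r.[0] == 0 -> exists r', r = r' * 'X.
  by rewrite -[_ == 0]/(root r 0) => /factor_theorem[r' ->]; exists r'; rewrite subr0.
have X0 : ('X : {poly A}) != 0 by rewrite polyX_eq0.
case/orP => /factor0[r rE].
  have [|a [m [a0 rm]]] := IHn r q.
    by apply: (mulfI X0); rewrite mulrA [_ * r]mulrC -rE e exprS.
  by exists a, m.+1; split=> //; rewrite rE rm exprSr scalerAl.
by apply: (IHn p r); apply: (mulfI X0); rewrite mulrCA [_ * r]mulrC -rE e exprS.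
Qed.

Section OneModel.
Variables (K : numClosedFieldType) (d l : nat) (U : comAlgType K).
Variable M : model d l U.
Hypothesis l_gt0 : (0 < l)%N.

Local Notation x := (mx M).
Local Notation y := (my M).
Local Notation z := (mz M).
Local Notation t := (mt M).
Local Notation ti := (mti M).
Local Notation e0 := (e0 M).
Local Notation e1 := (e1 M).
Local Notation e2 := (e2 M).
Local Notation "{ a , b }" := (br M a b).

Lemma tiK k u : ti ^+ k * (t ^+ k * u) = u.
Proof. by rewrite mulrA -exprMn [ti * t]mulrC m_ti expr1n mul1r. Qed.

Lemma e0_tn n : e0 'X^n = t ^+ n.
Proof. by rewrite e0Xn e0X. Qed.

Lemma e1_tn n : e1 ('X%:P ^+ n) = t ^+ n.
Proof. by rewrite -(e2C M) polyC_exp e2_tn. Qed.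

Lemma y_neq0 : y <> 0.
Proof.
by rewrite -(e2X M) => /(@e2_inj _ _ _ _ M)/eqP; rewrite polyX_eq0.
Qed.

Lemma x_nonunit u : x * u <> 1.
Proof.
move=> e; have : e0 1 = x * u by rewrite e; apply: rmorph1.
by move/(@m_free _ _ _ _ M)/eqP; rewrite oner_eq0.
Qed.

Lemma brDl a b u : {a + b, u} = {a, u} + {b, u}.
Proof. by rewrite br_alt (derD (br_der M u)) opprD -!br_alt. Qed.
Lemma brNl a u : {- a, u} = - {a, u}.
Proof. by rewrite [LHS]br_alt (derN (br_der M u)) opprK [LHS]br_alt. Qed.
Lemma br_scalarl c u : {c%:A, u} = 0.
Proof. by rewrite br_alt (der_scalar (br_der M u)) oppr0. Qed.

Lemma br_tn a k u : {a, t ^+ k * u} = t ^+ k * {a, u}.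
Proof.
have h := br_der M a.
by rewrite (derM h) derX // br_t mulr0 mul0r add0r.
Qed.

Lemma br_xn N u : {x, x ^+ N * u} = x ^+ N * {x, u}.
Proof.
have h := br_der M x.
by rewrite (derM h) derX // br_diag mulr0 mul0r add0r.
Qed.

Lemma br_x_e2 P : {x, e2 P} = e2 P^`() * x ^+ d.
Proof. by rewrite (der_e2 _ (br_der M x) (br_t M x)) br_diag mulr0 add0r br_xy. Qed.

Lemma br_x_rep N k u P : x ^+ N * (t ^+ k * u) = e2 P ->
  x ^+ N * (t ^+ k * {x, u}) = e2 P^`() * x ^+ d.
Proof. by rewrite -br_tn -br_xn => ->; apply: br_x_e2. Qed.

Lemma br_x_rep0 N k u P : x ^+ N * (t ^+ k * u) = e2 P ->
  {x, u} = 0 <-> P^`() = 0.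
Proof.
move/br_x_rep => e; split=> [h|h]; move: e; rewrite h.
  rewrite !mulr0 => /esym/(m_domain M)[/(@e2_inj _ _ _ _ M) //|].
  by move/(xn_neq0 (M := M)).
rewrite (rmorph0 e2) mul0r => /(m_domain M)[/(xn_neq0 (M := M)) //|].
by move/(m_domain M) => [/(tn_neq0 (M := M)) //|].
Qed.

(** The kernel consists of the elements of degree 0 in y; by [low_degree] they have no pole in x, so
    only a power of t is left to clear. *)
Lemma br_x_ker u : {x, u} = 0 -> exists k c, t ^+ k * u = e1 c.
Proof.
move=> xu; have [k hk] := inB_gen M u; have [N [P e]] := repB hk.
have P'0 := (br_x_rep0 e).1 xu.
have sP : (size P <= 1)%N.
  by rewrite (deriv_eq0 (@charP2 K) P'0) size_polyC_leq1.
have [Q eQ] := low_degree l_gt0 hk e (leq_trans sP l_gt0).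
exists k, Q`_0; rewrite eQ -e2C; congr e2.
apply: (deriv_eq0 (@charP2 K)).
by apply: (@br_x_rep0 0%N k u Q _).1; rewrite ?mul1r.
Qed.

(** The kernel is factorially closed because the degree in y is additive. *)
Lemma br_x_factor u v : {x, u * v} = 0 -> u * v <> 0 -> {x, u} = 0.
Proof.
move=> h nz.
have [N [k [P e]]] := rep M u; have [N' [k' [Q e']]] := rep M v.
have ePQ : x ^+ (N + N') * (t ^+ (k + k') * (u * v)) = e2 (P * Q).
  by rewrite e2M -e -e' !exprD; ring.
have PQ := deriv_eq0 (@charP2 K) ((br_x_rep0 ePQ).1 h).
apply/(br_x_rep0 e); rewrite (@size1_polyC _ P) ?derivC //.
apply: (size_mulC_le1 _ PQ); apply/eqP => c0.
have : e2 (P * Q) = 0 by rewrite PQ c0; apply: rmorph0.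
rewrite -ePQ => /(m_domain M)[/(xn_neq0 (M := M)) //|].
by move/(m_domain M) => [/(tn_neq0 (M := M)) //|].
Qed.

(** A unit and its inverse lie in the kernel of the bracket with x, so up to powers of t they are
    polynomials in x over K[t] whose product is a power of t. *)
Lemma unit_form u v : u * v = 1 ->
  exists k m (a : K), a != 0 /\ t ^+ k * u = a *: t ^+ m.
Proof.
move=> uv.
have xuv : {x, u * v} = 0 by rewrite uv (der1 (br_der M x)).
have uv0 : u * v <> 0 by rewrite uv; apply/eqP/oner_neq0.
have [k [c ec]] := br_x_ker (br_x_factor xuv uv0).
rewrite mulrC in xuv uv0.
have [m [c' ec']] := br_x_ker (br_x_factor xuv uv0).
have cc : c * c' = 'X^(k + m)%:P.
  apply: (@polyC_inj _); apply: (e2_eq (M := M)).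
  rewrite polyCM e2M !e2C -ec -ec' e1C e0_tn exprD.
  by transitivity (t ^+ k * t ^+ m * (u * v)); [ring | rewrite uv mulr1].
have c1 : c = (c`_0)%:P.
  by apply/size1_polyC/(size_mulC_le1 _ cc); rewrite expf_neq0 // polyX_eq0.
have c1' : c' = (c'`_0)%:P.
  apply/size1_polyC/(@size_mulC_le1 _ _ c ('X^(k + m))); last by rewrite mulrC.
  by rewrite expf_neq0 // polyX_eq0.
have /polyC_inj/monomial_factor[a [n [a0 an]]] : (c`_0 * c'`_0)%:P = ('X^(k + m))%:P.
  by rewrite polyCM -c1 -c1' cc.
exists k, n, a; split=> //; rewrite ec c1 e1C an.
by rewrite -mul_polyC e0M e0_tn e0C mulr_algl.
Qed.

(** This is what carries the condition of killing t through an isomorphism: the image of t is a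
    unit. *)
Lemma br_unit a u v : u * v = 1 -> {a, u} = 0.
Proof.
move=> /unit_form[k [m [c [_ e]]]].
have := br_tn a k u; rewrite e (derZ (br_der M a)) -[t ^+ m]mulr1 br_tn.
rewrite (der1 (br_der M a)) mulr0 scaler0 => /esym/(m_domain M)[] //.
by move/(tn_neq0 (M := M)).
Qed.

Lemma br_x_ext D : is_derivation D -> D t = 0 -> D x = 0 ->
  forall u, x ^+ d * D u = D y * {x, u}.
Proof.
move=> hD Dt Dx; apply: (der_ext (M := M)) => //.
- exact: br_der.
- exact: br_t.
- by rewrite Dx br_diag !mulr0.
by rewrite br_xy mulrC.
Qed.

Lemma br_nil a : (exists n, iter n (br M a) x = 0) -> (exists n, iter n (br M a) y = 0) ->
  (exists n, iter n (br M a) z = 0) -> loc_nilpotent (br M a).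
Proof.
move=> hx hy hz u; have h := br_der M a.
have [k [hk]] := inB_gen M u.
have [n e] : exists n, iter n (br M a) (t ^+ k * u) = 0.
  apply: (hk (fun v => exists n, iter n (br M a) v = 0)) => //.
  - by move=> c; exists 1%N; rewrite /= der_scalar.
  - by move=> ? ?; apply: nilpD.
  by move=> ? ?; apply: nilpM.
exists n; move: e; rewrite (der_iter_const h) => [/(m_domain M)[/(tn_neq0 (M := M))|] //|].
by rewrite derX // br_t mulr0.
Qed.

Lemma br_x_nil : loc_nilpotent (br M x).
Proof.
have h := br_der M x.
have ny : exists n, iter n (br M x) y = 0.
  by exists 2%N; rewrite /= br_xy derX // br_diag mulr0.
apply: br_nil => //; first by exists 1%N; rewrite /= br_diag.
suff [n e] : exists n, iter n (br M x) (l%:R * y ^+ l.-1) = 0.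
  by exists n.+1; rewrite iterSr br_xz.
apply: nilpM => //.
  by exists 1%N; rewrite /= -scaler_nat der_scalar.
elim: l.-1 => [|n IHn]; first by exists 1%N; rewrite /= expr0 der1.
by rewrite exprS; apply: nilpM.
Qed.

End OneModel.

Section OneDim.
Variables (K : numClosedFieldType) (l : nat) (U : comAlgType K).
Variable M : model 1 l U.
Local Notation x := (mx M).
Local Notation y := (my M).
Local Notation z := (mz M).
Local Notation t := (mt M).
Local Notation "{ a , b }" := (br M a b).

(** For d = 1 the relation becomes x w = t - y ^ l, in which w plays the same part as x. *)
Definition mw : U := 1 - mz M.

Lemma xw : x * mw = t - y ^+ l.
Proof. by have := m_rel M; rewrite expr1 /mw mulrBr mulr1 => ->; ring. Qed.

Lemma br_wl u : {mw, u} = - {z, u}.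
Proof. by rewrite /mw brDl brNl -[1]scale1r br_scalarl add0r. Qed.

Lemma br_wx : {mw, x} = l%:R * y ^+ l.-1.
Proof. by rewrite br_wl br_alt opprK br_xz. Qed.

Lemma br_wy : {mw, y} = - mw.
Proof. by rewrite br_wl br_alt opprK br_yz expr0 /mw; ring. Qed.

Lemma br_w_nil : loc_nilpotent (br M mw).
Proof.
have h := br_der M mw.
have ny : exists n, iter n (br M mw) y = 0.
  by exists 2%N; rewrite /= br_wy derN // br_diag oppr0.
apply: br_nil => //; last by exists 1%N; rewrite /= br_wl br_diag oppr0.
suff [n e] : exists n, iter n (br M mw) (l%:R * y ^+ l.-1) = 0.
  by exists n.+1; rewrite iterSr br_wx.
apply: nilpM => //.
  by exists 1%N; rewrite /= -scaler_nat der_scalar.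
elim: l.-1 => [|n IHn]; first by exists 1%N; rewrite /= expr0 der1.
by rewrite exprS; apply: nilpM.
Qed.

End OneDim.

(** * Isomorphisms with d >= 2 *)

Section Transport.
Variables (K : numClosedFieldType) (U1 U2 : comAlgType K).
Variables (F : {lrmorphism U1 -> U2}) (G : {lrmorphism U2 -> U1}).
Hypotheses (FK : cancel F G) (GK : cancel G F).

Lemma transport_der D : is_derivation D -> is_derivation (fun u => F (D (G u))).
Proof.
move=> hD; split=> [a b|a b|c a].
- by rewrite rmorphD (derD hD) rmorphD.
- by rewrite rmorphM (derM hD) rmorphD !rmorphM /= !GK.
by rewrite linearZ (derZ hD) linearZ.
Qed.

Lemma transport_nil D : loc_nilpotent D -> loc_nilpotent (fun u => F (D (G u))).
Proof.
move=> nil u; have [n e] := nil (G u); exists n.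
suff -> : iter n (fun u => F (D (G u))) u = F (iter n D (G u)) by rewrite e rmorph0.
by elim: n {e} => [|n IHn]; rewrite ?GK //= IHn FK.
Qed.

End Transport.

Section Compare.
Variables (K : numClosedFieldType) (d1 l1 d2 l2 : nat) (U1 U2 : comAlgType K).
Variables (M1 : model d1 l1 U1) (M2 : model d2 l2 U2).
Variables (F : {lrmorphism U1 -> U2}) (G : {lrmorphism U2 -> U1}).
Hypotheses (FK : cancel F G) (GK : cancel G F).
Hypotheses (l1_gt0 : (0 < l1)%N) (d2_ge2 : (2 <= d2)%N) (l2_ge2 : (2 <= l2)%N).

Local Notation x := (mx M2).
Local Notation y := (my M2).
Local Notation z := (mz M2).
Local Notation t := (mt M2).
Local Notation ti := (mti M2).
Local Notation e0 := (e0 M2).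
Local Notation e1 := (e1 M2).
Local Notation e2 := (e2 M2).
Local Notation "{ a , b }" := (br M2 a b).
Local Notation D a := (fun u => F (br M1 a (G u))).

Let D_der a : is_derivation (D a).
Proof. exact: transport_der (br_der M1 a). Qed.

Let D_t a : D a t = 0.
Proof.
rewrite /= (@br_unit _ _ _ _ M1 l1_gt0 _ _ (G ti)) ?rmorph0 //.
by rewrite -rmorphM m_ti rmorph1.
Qed.

Let D_F a u : D a (F u) = F (br M1 a u). Proof. by rewrite /= FK. Qed.

Lemma transport_kills_x a : loc_nilpotent (br M1 a) -> D a x = 0.
Proof.
by move=> nil; apply: lnd_kills_x => //; apply: transport_nil.
Qed.

Lemma transport_ext a : loc_nilpotent (br M1 a) ->
  forall u, x ^+ d2 * D a u = D a y * {x, u}.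
Proof. by move=> nil; apply: br_x_ext => //; apply: transport_kills_x. Qed.

Lemma F_neq0 u : u <> 0 -> F u <> 0.
Proof. by move=> u0 Fu; apply: u0; rewrite -(FK u) Fu rmorph0. Qed.

(** The transported bracket with x1 kills F x1 and is proportional to the bracket with x. The factor
    is nonzero, since F y1 is sent to F (x1 ^ d1), which is not 0. *)
Lemma br_x_Fx : {x, F (mx M1)} = 0.
Proof.
have nil := br_x_nil M1.
have := transport_ext nil (F (mx M1)); rewrite D_F br_diag rmorph0 mulr0.
move=> /esym/(m_domain M2)[] // h0.
have := transport_ext nil (F (my M1)); rewrite D_F br_xy h0 mul0r.
move/(m_domain M2) => [/(xn_neq0 (M := M2)) //|].
by move/F_neq0: (xn_neq0 (M := M1) (n := d1)).
Qed.

Let x_cancel n u v : x ^+ n * u = x ^+ n * v -> u = v.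
Proof. exact: (mulUI M2 (xn_neq0 (M := M2) (n := n))). Qed.
(* [{x, F y1}] divides a power of [F x1], hence lies in C[t^{+-1}, x]; so [F y1]
   has degree 1 in y. *)
Lemma image_xy : (0 < d1)%N -> exists k s r h w,
  [/\ F (mx M1) = x * w, t ^+ k * F (mx M1) ^+ d1 = x ^+ d2 * (e1 s * h)
    & t ^+ k * F (my M1) = e1 s * y + e1 r].
Proof.
move=> d1_gt0.
set X := F (mx M1); set Y := F (my M1); pose h := D (mx M1) y.
have ext := transport_ext (br_x_nil M1); rewrite -/h in ext.
have X0 : X <> 0 by apply: F_neq0; apply: m_x0.
have Xd0 : X ^+ d1 <> 0 by apply: (expU_neq0 M2).
have eXY : x ^+ d2 * X ^+ d1 = h * {x, Y}.
  by rewrite -ext /Y FK br_xy rmorphXn.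
have xXd : {x, h * {x, Y}} = 0.
  rewrite -eXY br_xn; have := derX (br_der M2 x) X d1.
  by rewrite br_x_Fx mulr0 => ->; rewrite mulr0.
have nz : h * {x, Y} <> 0.
  by rewrite -eXY; apply: (mulU_neq0 M2) => //; apply: xn_neq0.
have xh : {x, h} = 0 by apply: br_x_factor nz.
have xg : {x, {x, Y}} = 0 by rewrite mulrC in xXd nz; apply: br_x_factor nz.
have l2_gt0 : (0 < l2)%N by apply: ltnW.
(* Evaluate at z: x ^ d2 D z = l2 y ^ (l2 - 1) h has degree below l2 in y, so D z has no pole in x
   and x ^ d2 divides h. *)
have [h1 hE] : exists h1, h = x ^+ d2 * h1.
  have [k [c ec]] := br_x_ker l2_gt0 xh.
  have [m hm] := inB_gen M2 (D (mx M1) z).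
  have hmk : inB M2 (t ^+ (k + m) * D (mx M1) z).
    by rewrite exprD -mulrA; apply: inBtn.
  pose c' := 'X%:P ^+ m * c.
  have ec' : t ^+ (k + m) * h = e1 c'.
    by rewrite e1M e1_tn -ec exprD; ring.
  have e : x ^+ d2 * (t ^+ (k + m) * D (mx M1) z) = e2 ((c'%:P * 'X ^+ l2.-1) *+ l2).
    rewrite e2Mn e2M e2Xn e2X e2C -ec' mulrCA ext br_xz.
    by rewrite -[RHS]mulr_natr; ring.
  have sW : (size ((c'%:P * 'X ^+ l2.-1) *+ l2)%R <= l2)%N.
    apply/leq_sizeP => j lj; rewrite coefMn coefCM coefXn gtn_eqF ?mulr0 ?mul0rn //.
    by rewrite prednK.
  have [Q eQ] := low_degree l2_gt0 hmk e sW.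
  have : 'X%:P ^+ d2 * Q = (c'%:P * 'X ^+ l2.-1) *+ l2.
    by apply: (e2_eq (M := M2)); rewrite e2M e2_xn -eQ e.
  move/(congr1 (fun P : {poly {poly {poly K}}} => P`_l2.-1)).
  rewrite coef_XC_mul coefMn coefCM coefXn eqxx mulr1.
  move/(congr1 e1); rewrite e1M e1Xn e1X => eQ'.
  exists (l2%:R^-1 *: (ti ^+ (k + m) * e1 Q`_l2.-1)).
  apply: (@scalerI _ _ l2%:R _); first by rewrite pnatr_eq0 -lt0n.
  rewrite scalerAr scalerA divff ?pnatr_eq0 -?lt0n // scale1r mulrCA eQ'.
  by rewrite e1Mn -ec' scaler_nat mulrnAr tiK.
have gh : {x, Y} * h1 = X ^+ d1.
  by apply: (x_cancel (n := d2)); rewrite eXY hE; ring.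
(* As [{x, Y}] does not involve y, [Y] has degree at most 1 in y; this is below l2, so [low_degree]
   removes the pole in x. *)
have [k hk] := inB_gen M2 Y; have [N [P eP]] := repB hk.
have P2 : P^`()^`() = 0.
  have e : x ^+ N * (t ^+ k * {x, Y}) = e2 (P^`() * 'X%:P ^+ d2).
    by rewrite e2M e2_xn; apply: br_x_rep.
  have := (br_x_rep0 e).1 xg; rewrite derivM.
  have -> : ('X%:P ^+ d2 : {poly {poly {poly K}}})^`() = 0.
    by rewrite -polyC_exp derivC.
  rewrite mulr0 addr0 => /eqP; rewrite mulf_eq0 => /orP[/eqP//|].
  by rewrite expf_eq0 polyC_eq0 polyX_eq0 andbF.
have sP : (size P <= 2)%N.
  apply/leq_sizeP => -[|[|j]] // _; move/(congr1 (fun R : {poly {poly {poly K}}} => R`_j)): P2.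
  rewrite !coef_deriv coef0 -mulrnA => /eqP; rewrite -mulr_natr mulf_eq0.
  by case/orP => [/eqP//|]; rewrite mulSn mulnS addSn (negbTE (charP2 K _)).
have [S eS] : exists S, t ^+ k * Y = e2 S.
  exact: (low_degree l2_gt0 hk eP (leq_trans sP l2_ge2)).
have SE : S = (S`_1)%:P * 'X + (S`_0)%:P.
  have sS : (size S <= 2)%N.
    rewrite -(size_XC_mul _ N); suff -> : 'X%:P ^+ N * S = P by [].
    by apply: (e2_eq (M := M2)); rewrite e2M e2_xn -eS.
  apply/polyP => -[|[|j]]; rewrite coefD coefMX !coefC ?add0r ?addr0 //=.
  by rewrite nth_default // (leq_trans sS).
have tX : t ^+ k * X ^+ d1 = x ^+ d2 * (e1 S`_1 * h1).
  rewrite -gh mulrA -br_tn eS br_x_e2 {1}SE.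
  by rewrite derivD derivM !derivC derivX mul0r add0r mulr1 addr0 e2C; ring.
have [n [c ec]] := br_x_ker l2_gt0 br_x_Fx; rewrite -/X in ec.
have [r rE] : exists r, c = r * 'X + (c`_0)%:P.
  have /factor_theorem[r] : root (c - (c`_0)%:P) 0.
    by rewrite /root !hornerE horner_coef0 subrr.
  by rewrite subr0 => rE; exists r; rewrite -rE subrK.
have ecr : e1 c - e0 c`_0 = e1 r * x.
  by rewrite {1}rE e1D e1M e1X e1C addrK.
(* Modulo x, [tX] says that t ^ k times the d1-th power of the constant term of [c] is 0, because d2
   > 0; then [m_free] applies. [V] is the cofactor of a - b in a ^ d1 - b ^ d1. *)
have c0 : c`_0 = 0.
  have [u eu] : exists u, e0 ('X^k * c`_0 ^+ d1) = x * u.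
    pose V := \sum_(i < d1) e1 c ^+ (d1.-1 - i) * e0 c`_0 ^+ i.
    exists (t ^+ (n * d1) * (x ^+ d2.-1 * (e1 S`_1 * h1)) - t ^+ k * e1 r * V).
    have := subrXX (e1 c) (e0 c`_0) d1; rewrite ecr -/V => eV.
    rewrite e0M e0_tn e0Xn.
    have -> : e0 c`_0 ^+ d1 = e1 c ^+ d1 - e1 r * x * V by rewrite -eV; ring.
    have -> : t ^+ k * (e1 c ^+ d1 - e1 r * x * V) =
      t ^+ (n * d1) * (t ^+ k * X ^+ d1) - x * (t ^+ k * e1 r * V).
      by rewrite -ec exprMn -exprM; ring.
    rewrite tX; have -> : x ^+ d2 = x * x ^+ d2.-1 by rewrite -exprS prednK // ltnW.
    ring.
  have /eqP := m_free eu; rewrite mulf_eq0 expf_eq0 polyX_eq0 andbF /=.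
  by rewrite expf_eq0 => /andP[_ /eqP].
exists k, S`_1, S`_0, h1, (ti ^+ n * e1 r); split=> //.
  rewrite mulrCA [x * _]mulrC -ecr c0 [e0 0](rmorph0 e0) subr0 -ec.
  by rewrite tiK.
by rewrite eS {1}SE e2D e2M !e2C e2X.
Qed.

End Compare.

(* For [d1 = 1] there are two locally nilpotent derivations with different
   kernels; transported, both would be proportional to {x, .}. *)
Lemma no_iso_d1 (K : numClosedFieldType) (l1 d2 l2 : nat) (U1 U2 : comAlgType K)
    (M1 : model 1 l1 U1) (M2 : model d2 l2 U2)
    (F : {lrmorphism U1 -> U2}) (G : {lrmorphism U2 -> U1}) :
  cancel F G -> cancel G F -> (0 < l1)%N -> (2 <= d2)%N -> (2 <= l2)%N -> False.
Proof.
move=> FK GK l1_gt0 d2_ge2 l2_ge2.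
have := transport_ext M2 FK GK l1_gt0 d2_ge2 l2_ge2 (br_w_nil M1) (F (mx M1)).
rewrite (br_x_Fx M1 M2 FK GK) // mulr0 FK => /(m_domain M2)[/(xn_neq0 (M := M2)) //|].
rewrite br_wx; apply: F_neq0 FK _ _; apply: (mulU_neq0 M1).
  by case: l1 l1_gt0 {M1} => // l _; apply: natU_neq0.
by apply: (expU_neq0 M1); apply: y_neq0.
Qed.

Lemma iso_le (K : numClosedFieldType) (d1 l1 d2 l2 : nat) (U1 U2 : comAlgType K)
    (M1 : model d1 l1 U1) (M2 : model d2 l2 U2)
    (F : {lrmorphism U1 -> U2}) (G : {lrmorphism U2 -> U1}) :
  cancel F G -> cancel G F -> (2 <= d1)%N -> (2 <= l1)%N -> (2 <= d2)%N -> (2 <= l2)%N ->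
  (d2 <= d1)%N /\ (d1 = d2 -> (l2 <= l1)%N).
Proof.
move=> FK GK d1_ge2 l1_ge2 d2_ge2 l2_ge2.
have [l1_gt0 l2_gt0] := (ltnW l1_ge2, ltnW l2_ge2).
have [d1_gt0 d2_gt0] := (ltnW d1_ge2, ltnW d2_ge2).
have [k [s [r [h [w [eX eXd eY]]]]]] :=
  image_xy M1 M2 FK GK l1_gt0 d2_ge2 l2_ge2 d1_gt0.
have [_ [_ [_ [_ [w' [eX' _ _]]]]]] :=
  image_xy M2 M1 GK FK l2_gt0 d1_ge2 l1_ge2 d2_gt0.
set x := mx M2 in eX eXd *; set y := my M2 in eY; set t := mt M2 in eXd eY.
have xc n u v : x ^+ n * u = x ^+ n * v -> u = v by exact: (mulUI M2 (xn_neq0 (M := M2) (n := n))).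
(* The two directions of [image_xy] give x = F (x1 w') = x w F w', so [w] is a unit. *)
have wv : w * F w' = 1.
  have : F (mx M1 * w') = x by rewrite -eX' GK.
  by rewrite rmorphM /= eX -mulrA => e; apply: (xc 1%N); rewrite expr1 e mulr1.
have t_nonx n u : t ^+ n <> x * u.
  move=> e; apply: (@x_nonunit _ _ _ _ M2 (mti M2 ^+ n * u)).
  by rewrite mulrCA -e -[t ^+ n]mulr1 tiK.
(* If d1 < d2, cancelling x ^ d1 in [eXd] would make a unit a multiple of x. *)
have d21 : (d2 <= d1)%N.
  rewrite leqNgt; apply/negP => lt.
  apply: (t_nonx k (x ^+ (d2 - d1).-1 * (e1 M2 s * h) * F w' ^+ d1)).
  apply: (xc d1); rewrite -[LHS]mulr1 -(expr1n _ d1) -wv exprMn.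
  transitivity (t ^+ k * (x * w) ^+ d1 * F w' ^+ d1); first by rewrite exprMn; ring.
  rewrite -eX eXd.
  have -> : x ^+ d2 = x ^+ d1 * (x * x ^+ (d2 - d1).-1).
    by rewrite -exprS -exprD; congr (_ ^+ _); lia.
  by ring.
split=> // ed; rewrite leqNgt; apply/negP => l12.
(* For d1 = d2 the same equation makes the coefficient [s] of y in F y1 a unit. *)
have sv : e1 M2 s * (h * (F w') ^+ d1 * mti M2 ^+ k) = 1.
  transitivity (mti M2 ^+ k * (e1 M2 s * h * F w' ^+ d1)); first by ring.
  suff -> : e1 M2 s * h * F w' ^+ d1 = t ^+ k * 1 by rewrite tiK.
  apply: (xc d1); rewrite -[1](expr1n _ d1) -wv !exprMn.
  transitivity (x ^+ d1 * (e1 M2 s * h) * F w' ^+ d1); first by ring.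
  by rewrite {1}ed -eXd eX exprMn; ring.
set v := h * _ * _ in sv.
have [k' [m [a [a0 eT]]]] : exists k m (a : K), a != 0 /\ t ^+ k * F (mt M1) = a *: t ^+ m.
  apply: (@unit_form _ _ _ _ M2 l2_gt0 _ (F (mti M1))).
  by rewrite -rmorphM m_ti rmorph1.
have [n [c ec]] := br_x_ker l2_gt0 (br_x_Fx M1 M2 FK GK l1_gt0 d2_ge2 l2_ge2).
(* By the image of the relation, x ^ d2 Z has degree l1 in y. If l1 < l2, [low_degree] makes Z a
   polynomial up to powers of t, so x divides the coefficient of y ^ l1; but that one is a power of
   t times s ^ l1, a unit. *)
pose Z := w ^+ d1 * F (mz M1).
have eZ : x ^+ d2 * Z = F (my M1) ^+ l1 + F (mx M1) - F (mt M1).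
  have := congr1 F (m_rel M1); rewrite rmorphB rmorphD rmorphM !rmorphXn /= => <-.
  by rewrite eX exprMn /Z -{1}ed; ring.
have [p hp] := inB_gen M2 Z.
rewrite -/t in ec hp.
(* A common exponent of t: [p] for [Z], [n] for F x1 and [k'] for F t1; [k * l1] is added for the
   l1-th power of F y1. *)
pose E := (p + n + k')%N.
pose W0 := 'X%:P ^+ (E + k * l1 - n) * c
   - ('X ^+ (E + k * l1 - k' + m))%:P * a%:P%:P : {poly {poly K}}.
pose W : {poly {poly {poly K}}} := ('X%:P ^+ E)%:P * (s%:P * 'X + r%:P) ^+ l1 + W0%:P.
have sl : (size (s%:P * 'X + r%:P)%R <= 2)%N.
  apply: leq_trans (size_polyD _ _) _; rewrite geq_max.
  rewrite (leq_trans (size_polyC_leq1 _)) // andbT mul_polyC.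
  by rewrite (leq_trans (size_scale_leq _ _)) // size_polyX.
have sX q : (size ((s%:P * 'X + r%:P) ^+ q)%R <= q.+1)%N /\
    ((s%:P * 'X + r%:P) ^+ q)`_q = s ^+ q.
  elim: q => [|q [IH1 IH2]]; first by rewrite expr0 size_poly1 coefC.
  have cE := coef_top sl IH1; rewrite add1n in cE.
  rewrite !exprS cE IH2 (size_mul_top sl IH1); split=> //.
  by rewrite coefD coefCM coefX coefC mulr1 addr0.
have sW : (size W <= l2)%N.
  apply: leq_trans (size_polyD _ _) _; rewrite geq_max.
  rewrite mul_polyC (leq_trans (size_scale_leq _ _)); last first.
    by apply: leq_trans (sX l1).1 _.
  by rewrite (leq_trans (size_polyC_leq1 _)).
have hE : inB M2 (t ^+ (E + k * l1) * Z).
  rewrite (_ : (E + k * l1)%N = (n + k' + k * l1 + p)%N) ?exprD -?mulrA; last by rewrite /E; lia.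
  by do 3!apply: inBtn.
have eW : x ^+ d2 * (t ^+ (E + k * l1) * Z) = e2 M2 W.
  rewrite mulrCA eZ /W e2D e2M e2Xn e2D e2M !e2C e2X e1_tn -eY /W0 e1B !e1M e1_tn -ec.
  rewrite !e1C e0_tn e0C exprMn -exprM.
  have -> : t ^+ (E + k * l1) * (F (my M1) ^+ l1 + F (mx M1) - F (mt M1)) =
    t ^+ E * (t ^+ (k * l1) * F (my M1) ^+ l1) + t ^+ (E + k * l1 - n) * (t ^+ n * F (mx M1))
    - t ^+ (E + k * l1 - k') * (t ^+ k' * F (mt M1)).
    rewrite !mulrA -!exprD !subnK; [ring | rewrite /E; lia | rewrite /E; lia].
  rewrite eT exprD -[a *: t ^+ m]mulr_algl -/t; ring.
have [Q eQ] := low_degree l2_gt0 hE eW sW.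
have : 'X%:P ^+ d2 * Q = W by apply: (e2_eq (M := M2)); rewrite e2M e2_xn -eQ eW.
move/(congr1 (fun P : {poly {poly {poly K}}} => P`_l1)).
rewrite coef_XC_mul coefD coefCM (sX l1).2 coefC gtn_eqF // addr0.
move/(congr1 (e1 M2)); rewrite !e1M !e1Xn e1X e1C e0X => eq.
apply: (t_nonx E (x ^+ d2.-1 * e1 M2 Q`_l1 * v ^+ l1)).
rewrite -/t in eq; rewrite -[LHS]mulr1 -(expr1n _ l1) -sv exprMn [LHS]mulrA -eq.
by rewrite (_ : x ^+ d2 = x * x ^+ d2.-1); [ring | rewrite -exprS prednK].
Qed.

(** * Brackets modulo t - lam for d = 1 *)

Section Bracket.
Variables (K : numClosedFieldType) (l : nat) (U : comAlgType K).
Variable M : model 1 l U.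
Local Notation x := (mx M).
Local Notation y := (my M).
Local Notation z := (mz M).
Local Notation w := (mw M).
Local Notation t := (mt M).
Local Notation e2 := (e2 M).
Local Notation "{ a , b }" := (br M a b).
Local Notation R2 := {poly {poly {poly K}}}.

Lemma br_e2 P Q : {e2 P, e2 Q} = x * (e2 (dX P) * e2 Q^`() - e2 (dX Q) * e2 P^`()).
Proof.
rewrite (der_e2 _ (br_der M _) (br_t M _)).
rewrite [{e2 P, x}]br_alt [{e2 P, y}]br_alt br_x_e2.
rewrite (der_e2 P (br_der M y) (br_t M y)) br_diag br_yx expr1; ring.
Qed.

(** The bracket is x times the Jacobian in (x, y), and on numerators over x ^ N the operator x d/dx
    becomes x d/dx - N. *)
Lemma br_rep a b N k m n P Q :
  x ^+ N * (t ^+ k * a) = e2 P -> x ^+ m * (t ^+ n * b) = e2 Q ->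
  x ^+ (N + m) * (t ^+ (k + n) * {a, b}) =
  e2 (('X%:P * dX P - P *+ N) * Q^`() - P^`() * ('X%:P * dX Q - Q *+ m)).
Proof.
move=> eP eQ.
have pred_x j : x * (j%:R * x ^+ j.-1) = j%:R * x ^+ j.
  by case: j => [|j] /=; rewrite ?mul0r ?mulr0 // exprS; ring.
have xNd j u : x * {u, x ^+ j} = j%:R * x ^+ j * {u, x}.
  by rewrite (derX (br_der M u)) mulrA pred_x.
have E1 : x * (x ^+ m * (t ^+ n * {e2 P, b})) = x * ({e2 P, e2 Q} + e2 P^`() * e2 Q *+ m).
  have := congr1 (fun v => x * {e2 P, v}) eQ.
  rewrite (derM (br_der M _)) br_tn mulrDr => h.
  have h' : x * ({e2 P, x ^+ m} * (t ^+ n * b)) = - (x * (e2 P^`() * e2 Q *+ m)).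
    rewrite [LHS]mulrA xNd [{e2 P, x}]br_alt br_x_e2 expr1 -eQ -[_ *+ m]mulr_natl; ring.
  by rewrite mulrDr -h h'; ring.
have E1' : x ^+ m * (t ^+ n * {e2 P, b}) = {e2 P, e2 Q} + e2 P^`() * e2 Q *+ m.
  exact: (mulUI M (@m_x0 _ _ _ _ M) E1).
have E2 : x * (x ^+ N * (t ^+ k * {a, b})) = x * {e2 P, b} - (x ^+ N * (t ^+ k * a)) *+ N * {x, b}.
  have := congr1 (fun v => x * {b, v}) eP.
  have h' : x * ({b, x ^+ N} * (t ^+ k * a)) = N%:R * x ^+ N * {b, x} * (t ^+ k * a).
    by rewrite [LHS]mulrA xNd.
  rewrite (derM (br_der M _)) br_tn mulrDr h' [{b, x}]br_alt [{b, a}]br_alt.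
  rewrite [{b, e2 P}]br_alt => h.
  transitivity (- (N%:R * x ^+ N * - {x, b} * (t ^+ k * a) + x * (x ^+ N * (t ^+ k * - {a, b})))
     - (x ^+ N * (t ^+ k * a)) *+ N * {x, b}); last by rewrite h; ring.
  by rewrite -[_ *+ N]mulr_natl; ring.
have E3 := br_x_rep eQ; rewrite expr1 in E3.
apply: (mulUI M (@m_x0 _ _ _ _ M)).
transitivity (x ^+ m * (t ^+ n * (x * (x ^+ N * (t ^+ k * {a, b}))))).
  by rewrite !exprD; ring.
rewrite E2 eP.
transitivity (x * (x ^+ m * (t ^+ n * {e2 P, b})) - e2 P *+ N * (x ^+ m * (t ^+ n * {x, b}))).
  by ring.
rewrite E1' E3 br_e2 e2B !e2M !e2B !e2M !e2Mn !e2C !e1X; ring.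
Qed.

Section Functional.
Variable lam : K.
Hypothesis lam0 : lam != 0.
Hypothesis l_gt0 : (0 < l)%N.

(* The value at t = lam, as a polynomial in x over K[y]. *)
Definition sp (P : R2) : {poly {poly K}} :=
  swapXY (map_poly (map_poly (horner_eval lam)) P).

Lemma coef_sp P i j : (sp P)`_i`_j = (P`_j`_i).[lam].
Proof. by rewrite coef_swapXY !coef_map /= horner_evalE. Qed.

Lemma spM P Q : sp (P * Q) = sp P * sp Q.
Proof. by rewrite /sp !rmorphM. Qed.
Lemma spD P Q : sp (P + Q) = sp P + sp Q.
Proof. by rewrite /sp !rmorphD. Qed.
Lemma spB P Q : sp (P - Q) = sp P - sp Q.
Proof.
by apply/polyP => i; apply/polyP => j; rewrite !(coefB, coef_sp) hornerD hornerN.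
Qed.
Lemma spMn P n : sp (P *+ n) = sp P *+ n.
Proof. by rewrite /sp !rmorphMn. Qed.
Lemma spXn P n : sp (P ^+ n) = sp P ^+ n.
Proof. by rewrite /sp !rmorphXn. Qed.

Lemma spX : sp 'X%:P = 'X.
Proof. by rewrite /sp map_polyC /= map_polyX swapXY_polyC map_polyX. Qed.
Lemma spY : sp 'X = 'X%:P.
Proof. by rewrite /sp map_polyX swapXY_X. Qed.
Lemma spT : sp 'X%:P%:P = lam%:P%:P.
Proof.
apply/polyP => i; apply/polyP => j; rewrite coef_sp !coefC.
case: i => [|i]; case: j => [|j]; rewrite /= ?coefC ?coef0 /= ?hornerX ?horner0 //.
Qed.

Lemma sp_dX P : sp (dX P) = (sp P)^`().
Proof.
apply/polyP => i; apply/polyP => j; rewrite coef_sp coef_deriv coefMn coef_sp.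
by rewrite /dX coef_map_id0 ?deriv0 // coef_deriv hornerMn.
Qed.

Lemma sp_dY P i : (sp P^`())`_i = ((sp P)`_i)^`().
Proof.
by apply/polyP => j; rewrite coef_sp !coef_deriv coef_sp coefMn hornerMn.
Qed.

Definition qpol : {poly K} := 'X^l - lam%:P.

(** For a numerator [Q] over x ^ N, coefficient i belongs to x ^ (i - N). The property holds for z,
    as x z = (y ^ l - lam) + x at t = lam, and passes to sums and products. *)
Definition pole_dvd (N : nat) (Q : {poly {poly K}}) : Prop :=
  forall i, qpol ^+ (N - i) %| Q`_i.

Lemma pole_dvdD N Q Q' : pole_dvd N Q -> pole_dvd N Q' -> pole_dvd N (Q + Q').
Proof. by move=> h h' i; rewrite coefD dvdp_add. Qed.

Lemma pole_dvdM N m Q Q' : pole_dvd N Q -> pole_dvd m Q' -> pole_dvd (N + m) (Q * Q').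
Proof.
move=> h h' i; rewrite coefM; apply: (big_ind (fun p => _ %| p)) =>
  [||[j /= hj] _]; [exact: dvdp0 | exact: dvdp_add |].
apply: (@dvdp_trans _ (qpol ^+ (N - j) * qpol ^+ (m - (i - j)))); last exact: dvdp_mul.
by rewrite -exprD; apply: dvdp_exp2l; lia.
Qed.

Lemma pole_dvd0 Q : pole_dvd 0 Q. Proof. by move=> i; rewrite sub0n dvd1p. Qed.

Lemma pole_dvdXn N : pole_dvd N 'X^N.
Proof.
move=> i; rewrite coefXn; case: eqP => [->|_]; last exact: dvdp0.
by rewrite subnn dvd1p.
Qed.

Definition good_rep u N k P := x ^+ N * (t ^+ k * u) = e2 P /\ pole_dvd N (sp P).

Lemma good_rep_inB u : inB M u -> exists N P, good_rep u N 0 P.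
Proof.
case=> h; apply: (h (fun u => exists N P, good_rep u N 0 P)) =>
  [c|a b [N [P [e hP]]] [m [Q [e' hQ]]]|a b [N [P [e hP]]] [m [Q [e' hQ]]]|||].
- by exists 0%N, c%:P%:P%:P; split; [rewrite !mul1r !e2C e1C e0C | apply: pole_dvd0].
- exists (N + m)%N, ('X%:P ^+ m * P + 'X%:P ^+ N * Q); split.
    by rewrite e2D !e2M !e2_xn -e -e' exprD; ring.
  rewrite spD !spM !spXn spX; apply: pole_dvdD; last by apply: pole_dvdM => //; apply: pole_dvdXn.
  by rewrite addnC; apply: pole_dvdM => //; apply: pole_dvdXn.
- exists (N + m)%N, (P * Q); split; first by rewrite e2M -e -e' exprD; ring.
  by rewrite spM; apply: pole_dvdM.
- by exists 0%N, ('X%:P); split; [rewrite !mul1r e2C e1X | apply: pole_dvd0].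
- by exists 0%N, 'X; split; [rewrite !mul1r e2X | apply: pole_dvd0].
exists 1%N, (relp K l); split; first by rewrite e2_relp mul1r.
rewrite /relp spB spD spXn spX spY spT => -[|i]; last by rewrite subSS sub0n dvd1p.
by rewrite coefB coefD coefX -rmorphXn !coefC /= addr0 expr1.
Qed.

Lemma good_rep_ex u : exists N k P, good_rep u N k P.
Proof.
have [k hk] := inB_gen M u; have [N [P [e hP]]] := good_rep_inB hk.
by exists N, k, P; rewrite /good_rep -e mul1r.
Qed.

(** The coefficient of x ^ 0 at t = lam of the element whose product with x ^ N t ^ k is given by
    [P]; dividing by lam ^ k requires lam to be nonzero. *)
Definition coef_x0 (N k : nat) (P : R2) : {poly K} := (lam ^+ k)^-1 *: (sp P)`_N.

Lemma coef_x0_unique u N k P N' k' P' : x ^+ N * (t ^+ k * u) = e2 P ->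
  x ^+ N' * (t ^+ k' * u) = e2 P' -> coef_x0 N k P = coef_x0 N' k' P'.
Proof.
move=> e e'.
have : 'X%:P ^+ N' * ('X%:P%:P ^+ k' * P) = 'X%:P ^+ N * ('X%:P%:P ^+ k * P').
  by apply: (e2_eq (M := M)); rewrite !e2M !e2_xn !e2_tn -e -e'; ring.
move/(congr1 (fun Q => (sp Q)`_(N + N'))); rewrite !spM !spXn spX spT !coefXnM.
rewrite ltnNge leq_addl ltnNge leq_addr /= addnK addKn -!polyC_exp !coefCM !mul_polyC => h.
apply: (@scalerI _ _ (lam ^+ (k + k'))); first by rewrite expf_neq0.
rewrite /coef_x0 !scalerA exprD mulfK ?expf_neq0 //.
by rewrite [lam ^+ k * _]mulrC mulfK ?expf_neq0.
Qed.

Definition integ (p : {poly K}) : {poly K} :=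
  \poly_(i < (size p).+1) (p`_i.-1 *+ (i != 0) / i%:R).

Lemma coef_integ p i : (integ p)`_i = p`_i.-1 *+ (i != 0) / i%:R.
Proof.
rewrite coef_poly; case: ltnP => // h; case: i h => [|i] /= h; first by rewrite mul0r.
by rewrite nth_default // mul0rn mul0r.
Qed.

Lemma integD p q : integ (p + q) = integ p + integ q.
Proof. by apply/polyP=> i; rewrite coefD !coef_integ coefD mulrnDl mulrDl. Qed.

Lemma integZ c p : integ (c *: p) = c *: integ p.
Proof. by apply/polyP=> i; rewrite coefZ !coef_integ coefZ -mulrnAr mulrA. Qed.

Lemma integ_deriv p : integ p^`() = p - (p`_0)%:P.
Proof.
apply/polyP=> -[|i]; rewrite coef_integ coefB coefC /= ?mulr0n ?mul0r ?subrr //.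
by rewrite coef_deriv subr0 mulr1n -[_ *+ i.+1]mulr_natr mulfK // pnatr_eq0.
Qed.

(** Antiderivatives identify K[y] / (qpol K[y])' with K[y] / (K + qpol K[y]), which has basis y,
    ..., y ^ (l - 1); these are the coordinates, shifted by one to drop the constants. *)
Definition rho_poly (p : {poly K}) : 'rV[K]_l.-1 :=
  \row_(j < l.-1) (integ p %% qpol)`_j.+1.

Lemma rho_polyD p q : rho_poly (p + q) = rho_poly p + rho_poly q.
Proof. by apply/rowP=> j; rewrite !mxE integD modpD coefD. Qed.

Lemma rho_polyZ c p : rho_poly (c *: p) = c *: rho_poly p.
Proof. by apply/rowP=> j; rewrite !mxE integZ modpZl coefZ. Qed.

Lemma size_qpol : size qpol = l.+1.
Proof. exact: size_XnsubC. Qed.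

Lemma rho_poly_deriv p : rho_poly (qpol * p)^`() = 0.
Proof.
apply/rowP=> j; rewrite !mxE integ_deriv modpD modp_mulr add0r.
rewrite modp_small ?coefN ?coefC ?oppr0 //.
by rewrite size_polyN size_qpol ltnS (leq_trans (size_polyC_leq1 _)).
Qed.

Lemma rho_polyXn (j : 'I_l.-1) : rho_poly 'X^j = (j.+1%:R)^-1 *: delta_mx 0 j.
Proof.
have E : integ 'X^j = (j.+1%:R)^-1 *: 'X ^+ j.+1.
  apply/polyP=> -[|i]; rewrite coef_integ coefZ !coefXn /= ?mulr0n ?mul0r ?mulr0 //.
  by rewrite mulr1n eqSS; case: eqP => [->|_]; rewrite ?mul0r ?mulr0 ?mul1r ?mulr1.
apply/rowP=> i; rewrite !mxE E modp_small.
  by rewrite coefZ coefXn eqSS.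
rewrite size_qpol (leq_ltn_trans (size_scale_leq _ _)) // size_polyXn ltnS.
by case: j {E} => j /=; case: l.
Qed.

Lemma good_rep_sig u : exists r : nat * nat * R2, good_rep u r.1.1 r.1.2 r.2.
Proof. by have [N [k [P h]]] := good_rep_ex u; exists (N, k, P). Qed.

Definition rho u : 'rV[K]_l.-1 :=
  let r := sval (cid (good_rep_sig u)) in rho_poly (coef_x0 r.1.1 r.1.2 r.2).

Lemma rhoE u N k P : x ^+ N * (t ^+ k * u) = e2 P -> rho u = rho_poly (coef_x0 N k P).
Proof.
move=> e; rewrite /rho; case: cid => -[[N' k'] P'] /= [e' _].
by rewrite (coef_x0_unique e' e).
Qed.

Lemma rhoD u v : rho (u + v) = rho u + rho v.
Proof.
have [N [k [P [e _]]]] := good_rep_ex u; have [m [n [Q [e' _]]]] := good_rep_ex v.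
have E : x ^+ (N + m) * (t ^+ (k + n) * u) = e2 ('X%:P ^+ m * ('X%:P%:P ^+ n * P)).
  by rewrite !e2M e2_xn e2_tn -e !exprD; ring.
have E' : x ^+ (N + m) * (t ^+ (k + n) * v) = e2 ('X%:P ^+ N * ('X%:P%:P ^+ k * Q)).
  by rewrite !e2M e2_xn e2_tn -e' !exprD; ring.
have Es : x ^+ (N + m) * (t ^+ (k + n) * (u + v)) =
    e2 ('X%:P ^+ m * ('X%:P%:P ^+ n * P) + 'X%:P ^+ N * ('X%:P%:P ^+ k * Q)).
  by rewrite e2D -E -E'; ring.
by rewrite (rhoE E) (rhoE E') (rhoE Es) -rho_polyD /coef_x0 spD coefD scalerDr.
Qed.

Lemma rhoZ c u : rho (c *: u) = c *: rho u.
Proof.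
have [N [k [P [e _]]]] := good_rep_ex u.
have E : x ^+ N * (t ^+ k * (c *: u)) = e2 (c%:P%:P%:P * P).
  by rewrite e2M -e !e2C e1C e0C mulr_algl !scalerAr.
rewrite (rhoE E) (rhoE e) -rho_polyZ /coef_x0; congr rho_poly.
rewrite spM (_ : sp c%:P%:P%:P = c%:P%:P) ?coefCM ?mul_polyC ?scalerA 1?mulrC //.
apply/polyP => i; apply/polyP => j; rewrite coef_sp !coefC.
by case: i => [|i]; case: j => [|j]; rewrite /= ?coefC ?coef0 /= ?hornerC ?horner0.
Qed.

Lemma rho_t u : rho (t * u) = lam *: rho u.
Proof.
have [N [k [P [e _]]]] := good_rep_ex u.
have E : x ^+ N * (t ^+ k * (t * u)) = e2 ('X%:P%:P ^+ 1 * P).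
  by rewrite e2M e2_tn -e expr1; ring.
rewrite (rhoE E) (rhoE e) -rho_polyZ /coef_x0; congr rho_poly.
by rewrite expr1 spM spT coefCM mul_polyC !scalerA mulrC.
Qed.

Lemma rho_tn n u : rho (t ^+ n * u) = lam ^+ n *: rho u.
Proof.
elim: n => [|n IH]; first by rewrite !expr0 mul1r scale1r.
by rewrite !exprS -mulrA rho_t IH scalerA.
Qed.

Lemma rho_yn (j : 'I_l.-1) : rho (y ^+ j) = (j.+1%:R)^-1 *: delta_mx 0 j.
Proof.
have e : x ^+ 0 * (t ^+ 0 * y ^+ j) = e2 ('X ^+ j) by rewrite !mul1r e2Xn e2X.
rewrite (rhoE e) -rho_polyXn; congr rho_poly.
by rewrite /coef_x0 expr0 invr1 scale1r spXn spY -polyC_exp coefC.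
Qed.

(* The coefficient of x^0 in a bracket is the derivative in y of a multiple of
   [y ^ l - lam], because the coefficient of x^(-n) in an element of U is
   divisible by [(y ^ l - t) ^ n]. *)
Lemma rho_br a b : rho {a, b} = 0.
Proof.
have [N [k [P [e dP]]]] := good_rep_ex a; have [m [n [Q [e' dQ]]]] := good_rep_ex b.
rewrite (rhoE (br_rep e e')) /coef_x0 rho_polyZ.
set p := sp P in dP *; set q := sp Q in dQ *.
pose c i : K := i%:R - N%:R.
(* A primitive of the coefficient of x ^ 0: the exponents i - N and (N + m - i) - m of the two
   factors are opposite there, which turns the bracket into a total derivative in y. *)
pose S := \sum_(i < (N + m).+1) c i *: (p`_i * q`_(N + m - i)).
have cE (i j : nat) (r : {poly {poly K}}) : ('X * r^`() - r *+ j)`_i = (i%:R - j%:R : K) *: r`_i.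
  rewrite coefB coefXM coefMn scalerBl !scaler_nat; congr (_ - _).
  by case: i => [|i] //=; rewrite coef_deriv.
have -> : (sp (('X%:P * dX P - P *+ N) * Q^`() - P^`() * ('X%:P * dX Q - Q *+ m)))`_(N + m) = S^`().
  rewrite spB !spM !spB !spM !spMn !spX !sp_dX -/p -/q coefB !coefM -sumrB raddf_sum.
  apply: eq_bigr => -[i /= hi] _; rewrite !cE !sp_dY -/p -/q derivZ derivM /c.
  have -> : ((N + m - i)%:R - m%:R : K) = - (i%:R - N%:R).
    by rewrite natrB // natrD; ring.
  by rewrite -!mul_polyC polyCN; ring.
have [S' ->] : exists S', S = qpol * S'.
  suff /dvdpP[S' ->] : qpol %| S by exists S'; rewrite mulrC.
  apply: (big_ind (fun r => qpol %| r)) => [||[i /= hi] _]; [exact: dvdp0 | exact: dvdp_add |].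
  (* For i < N the factor from [p] is divisible by [qpol], for i > N the factor from [q], and for i
     = N the scalar [c i] vanishes. *)
  case: (ltngtP i N) => h; last by rewrite /c h subrr scale0r dvdp0.
  - rewrite -mul_polyC; apply: dvdp_mull; apply: dvdp_mulr; apply: dvdp_trans (dP i).
    by rewrite dvdp_exp ?dvdpp // subn_gt0.
  rewrite -mul_polyC; apply: dvdp_mull; apply: dvdp_mull; apply: dvdp_trans (dQ _).
  by rewrite dvdp_exp ?dvdpp //; lia.
by rewrite rho_poly_deriv scaler0.
Qed.

End Functional.
End Bracket.

Section Span.
Variables (K : numClosedFieldType) (l : nat) (U : comAlgType K).
Variable M : model 1 l U.
Hypothesis l_ge2 : (2 <= l)%N.
Local Notation x := (mx M).
Local Notation y := (my M).
Local Notation z := (mz M).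
Local Notation w := (mw M).
Local Notation t := (mt M).
Local Notation "{ a , b }" := (br M a b).

Variables (n : nat) (m : U -> 'rV[K]_n).
Hypotheses (mD : forall u v, m (u + v) = m u + m v)
  (mZ : forall c u, m (c *: u) = c *: m u)
  (m_br : forall u v, m {u, v} = 0) (m_t : forall u, m (t * u) = m u).

(* Modulo brackets and t - 1 the algebra is spanned by 1, y, ..., y ^ (l - 2). *)
Definition mgens : 'M[K]_(l.-1, n) := \matrix_(j < l.-1) m (y ^+ j).

Let mN u : m (- u) = - m u.
Proof. by rewrite -scaleN1r mZ scaleN1r. Qed.

Let mnat k u : m (k%:R * u) = k%:R *: m u.
Proof. by rewrite -mZ scaler_nat mulr_natl. Qed.

Lemma m_yn j : (m (y ^+ j) <= mgens)%MS.
Proof.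
have [k] := ubnP j; elim: k j => // k IH j jk.
have [h|h] := ltnP j l.-1.
  have -> : m (y ^+ j) = row (Ordinal h) mgens by rewrite rowK.
  exact: row_sub.
pose s := (j - l.-1)%N.
(* As t acts as 1 under [m], this bracket expresses y ^ j by y ^ (j - l), and it kills y ^ (l - 1),
   where s = 0. *)
have e : {x * y ^+ s, w} = s%:R * (t * y ^+ s.-1) - (s + l)%:R * y ^+ j.
  rewrite br_alt (derM (br_der M w)) (derX (br_der M w)) br_wx br_wy.
  have -> : y ^+ j = y ^+ s * y ^+ l.-1 by rewrite -exprD subnK.
  have -> : t = x * w + y ^+ l by rewrite xw subrK.
  have sE : s%:R * y ^+ l * y ^+ s.-1 = s%:R * y ^+ s * y ^+ l.-1.
    case: (s) => [|s']; first by rewrite !mul0r.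
    rewrite -!mulrA -!exprD; congr (_ * y ^+ _); move: l_ge2; lia.
  transitivity (s%:R * x * w * y ^+ s.-1 - l%:R * y ^+ l.-1 * y ^+ s); first by ring.
  transitivity (s%:R * x * w * y ^+ s.-1 + s%:R * y ^+ l * y ^+ s.-1
     - (s + l)%:R * y ^+ s * y ^+ l.-1); last by ring.
  by rewrite sE natrD; ring.
have := m_br (x * y ^+ s) w; rewrite e mD mN !mnat m_t => /eqP.
rewrite subr_eq0 => /eqP e'.
have sl0 : ((s + l)%:R : K) != 0 by rewrite pnatr_eq0; move: l_ge2; lia.
rewrite -[m (y ^+ j)]scale1r -(mulVf sl0) -scalerA -e'.
apply: scalemx_sub; case: (posnP s) => [->|s0]; first by rewrite scale0r sub0mx.
by apply: scalemx_sub; apply: IH; move: jk; rewrite /s in s0 *; lia.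
Qed.

Lemma m_diag i j : (m (x ^+ i * y ^+ j * w ^+ i) <= mgens)%MS.
Proof.
elim: i j => [|i IH] j; first by rewrite mul1r mulr1 m_yn.
have -> : x ^+ i.+1 * y ^+ j * w ^+ i.+1 =
    t * (x ^+ i * y ^+ j * w ^+ i) - x ^+ i * y ^+ (j + l) * w ^+ i.
  transitivity (x ^+ i * y ^+ j * w ^+ i * (x * w)); first by rewrite !exprS; ring.
  by rewrite xw exprD; ring.
by rewrite mD mN m_t -scaleN1r addmx_sub ?scalemx_sub.
Qed.

(** The bracket with y multiplies this monomial by k - i, so for i <> k the monomial is itself a
    multiple of a bracket. *)
Lemma m_monom i j k : (m (x ^+ i * y ^+ j * w ^+ k) <= mgens)%MS.
Proof.
have [->|ne] := eqVneq i k; first exact: m_diag.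
have pred u c (q : nat) : br M y u = c * u -> br M y (u ^+ q) = q%:R * c * u ^+ q.
  move=> e; rewrite (derX (br_der M y)) e.
  by case: q => [|q] /=; rewrite ?mul0r // exprS; ring.
have ex : {y, x} = (-1) * x by rewrite br_yx expr1 mulN1r.
have ew : {y, w} = 1 * w by rewrite br_alt br_wy opprK mul1r.
have ey : {y, y} = 0 * y by rewrite br_diag mul0r.
have e : {y, x ^+ i * y ^+ j * w ^+ k} = k%:R * (x ^+ i * y ^+ j * w ^+ k)
     - i%:R * (x ^+ i * y ^+ j * w ^+ k).
  by rewrite !(derM (br_der M y)) (pred _ _ _ ex) (pred _ _ _ ey) (pred _ _ _ ew); ring.
have := m_br y (x ^+ i * y ^+ j * w ^+ k); rewrite e mD mN !mnat -scalerBl.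
move/eqP; rewrite scaler_eq0 subr_eq0 eqr_nat eq_sym (negbTE ne) /= => /eqP ->.
exact: sub0mx.
Qed.

Lemma m_span u : (m u <= mgens)%MS.
Proof.
(* Products are reached by letting [v] act on all monomials: the induction over generators then
   shows that multiplication by an element of the algebra preserves [S]. *)
pose S v := forall i j k, (m (v * (x ^+ i * y ^+ j * w ^+ k)) <= mgens)%MS.
have S1 : S 1 by move=> i j k; rewrite mul1r m_monom.
have SD v v' : S v -> S v' -> S (v + v').
  by move=> h h' i j k; rewrite mulrDl mD addmx_sub.
have SZ c v : S v -> S (c *: v).
  by move=> h i j k; rewrite -scalerAl mZ scalemx_sub.
have Sx v : S v -> S (x * v).
  move=> h i j k; rewrite (_ : _ * _ = v * (x ^+ i.+1 * y ^+ j * w ^+ k)) ?h //.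
  by rewrite exprS; ring.
have Sy v : S v -> S (y * v).
  move=> h i j k; rewrite (_ : _ * _ = v * (x ^+ i * y ^+ j.+1 * w ^+ k)) ?h //.
  by rewrite exprS; ring.
have Sw v : S v -> S (w * v).
  move=> h i j k; rewrite (_ : _ * _ = v * (x ^+ i * y ^+ j * w ^+ k.+1)) ?h //.
  by rewrite exprS; ring.
have Sz v : S v -> S (z * v).
  move=> h; rewrite (_ : z * v = v + (-1) *: (w * v)).
    by apply: SD => //; apply: SZ; apply: Sw.
  by rewrite scaleN1r /mw; ring.
have [k hk] := inB_gen M u.
have : S (t ^+ k * u * 1).
  case: hk => hk; apply: (hk (fun v => forall v', S v' -> S (v * v'))) => //.
  - by move=> c v Sv; rewrite mulr_algl; apply: SZ.
  - by move=> a b ha hb v Sv; rewrite mulrDl; apply: SD; [apply: ha | apply: hb].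
  by move=> a b ha hb v Sv; rewrite -mulrA; apply: ha; apply: hb.
move/(_ 0%N 0%N 0%N); rewrite !mulr1.
by elim: k {hk} => [|k IH]; rewrite ?mul1r // exprS -mulrA m_t.
Qed.

End Span.

Section CompareOne.
Variables (K : numClosedFieldType) (l1 l2 : nat) (U1 U2 : comAlgType K).
Variables (M1 : model 1 l1 U1) (M2 : model 1 l2 U2).
Variables (F : {lrmorphism U1 -> U2}) (G : {lrmorphism U2 -> U1}).
Hypotheses (FK : cancel F G) (GK : cancel G F).
Hypotheses (l1_gt0 : (0 < l1)%N) (l2_gt0 : (0 < l2)%N).
Local Notation x := (mx M1).
Local Notation y := (my M1).
Local Notation w := (mw M1).
Local Notation t := (mt M1).

Lemma br_l_der (b : U1) : is_derivation (fun a => br M1 a b).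
Proof.
have h := br_der M1 b; split=> [u v|u v|c u]; rewrite [LHS]br_alt.
- by rewrite (derD h) opprD -!br_alt.
- by rewrite (derM h) opprD [br M1 u b]br_alt [br M1 v b]br_alt; ring.
by rewrite (derZ h) -scalerN -br_alt.
Qed.

(* The transported bracket is a biderivation vanishing on t, hence a multiple of
   the bracket of U1. *)
Lemma transport_br : exists v, forall a b, G (br M2 (F a) (F b)) = v * br M1 a b.
Proof.
pose B a b := G (br M2 (F a) (F b)).
have Bder a : is_derivation (B a) by apply: (transport_der FK) (br_der M2 (F a)).
have Balt a b : B b a = - B a b by rewrite /B br_alt rmorphN.
have Bderl b : is_derivation (fun a => B a b).
  have h := Bder b; split=> [u v|u v|c u]; rewrite [LHS]Balt.
  - by rewrite (derD h) opprD -!Balt.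
  - by rewrite (derM h) opprD [B u b]Balt [B v b]Balt; ring.
  by rewrite (derZ h) -scalerN -Balt.
have Bt a : B a t = 0.
  rewrite /B (@br_unit _ _ _ _ M2 l2_gt0 _ _ (F (mti M1))) ?rmorph0 //.
  by rewrite -rmorphM m_ti rmorph1.
have Bd a : B a a = 0 by rewrite /B br_diag rmorph0.
have br_tl b : br M1 t b = 0 by rewrite br_alt br_t oppr0.
have two_r a b : x * B a x = B x y * br M1 a x -> x * B a y = B x y * br M1 a y ->
    x * B a b = B x y * br M1 a b.
  by move=> hx hy; apply: (der_ext (Bder a) (br_der M1 a) (Bt a) (br_t M1 a) hx hy).
(* Both sides are derivations in each variable and kill t, so it is enough to compare them on x and
   y. *)
have two a b : x * B a b = B x y * br M1 a b.
  apply: (der_ext (M := M1) (D1 := fun u => B u b) (D2 := fun u => br M1 u b)) => //.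
  - exact: br_l_der.
  - by rewrite Balt Bt oppr0.
  - by apply: two_r; rewrite ?Bd ?br_diag ?mulr0 // br_xy expr1 mulrC.
  by apply: two_r; rewrite ?Bd ?br_diag ?mulr0 // [B y x]Balt br_yx expr1; ring.
have l1K : (l1%:R : K) != 0 by rewrite pnatr_eq0 -lt0n.
(* The quotient of B x y by x. Expanding B x t = 0 gives x B x w = - l y ^ (l - 1) B x y; inserted
   in t B x y = (x w + y ^ l) B x y, this exhibits a factor x. *)
pose v := mti M1 * (B x y * w - l1%:R^-1 *: (y * B x w)).
have e0 : x * B x w = - (l1%:R * y ^+ l1.-1 * B x y).
  have := Bt x; have -> : t = x * w + y ^+ l1 by rewrite xw subrK.
  rewrite (derD (Bder x)) (derM (Bder x)) (derX (Bder x)) Bd mul0r add0r.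
  by move/eqP; rewrite addr_eq0 => /eqP.
have vx : v * x = B x y.
  rewrite /v -[RHS]mul1r -(m_ti M1).
  transitivity (mti M1 * (B x y * (x * w) - (l1%:R^-1 *: y) * (x * B x w))).
    rewrite -mulrA mulrBl; congr (_ * (_ - _)); first by ring.
    by rewrite -!scalerAl; congr (_ *: _); ring.
  rewrite e0 mulrN opprK xw.
  have -> : (l1%:R^-1 *: y) * (l1%:R * y ^+ l1.-1 * B x y) = y ^+ l1 * B x y.
    rewrite -scalerAl; transitivity (l1%:R^-1 *: (l1%:R * (y ^+ l1 * B x y))).
      congr (_ *: _); have -> : y ^+ l1 = y * y ^+ l1.-1 by rewrite -exprS prednK.
      by ring.
    by rewrite mulr_natl -scaler_nat scalerA mulVf // scale1r.
  by ring.
exists v => a b; apply: (mulUI M1 (@m_x0 _ _ _ _ M1)).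
by rewrite two -vx; ring.
Qed.

End CompareOne.

Lemma iso_le_d1 (K : numClosedFieldType) (l1 l2 : nat) (U1 U2 : comAlgType K)
  (M1 : model 1 l1 U1) (M2 : model 1 l2 U2)
  (F : {lrmorphism U1 -> U2}) (G : {lrmorphism U2 -> U1}) :
  cancel F G -> cancel G F -> (2 <= l1)%N -> (2 <= l2)%N -> (l1 <= l2)%N.
Proof.
move=> FK GK l1_ge2 l2_ge2; have [l1_gt0 l2_gt0] := (ltnW l1_ge2, ltnW l2_ge2).
have [v hv] := transport_br M1 M2 FK l1_gt0 l2_gt0.
have [v' hv'] := transport_br M2 M1 GK l2_gt0 l1_gt0.
have vv : v * G v' = 1.
  have nz : br M1 (mx M1) (my M1) <> 0 by rewrite br_xy; apply: xn_neq0.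
  apply: (mulUI M1 nz).
  transitivity (G v' * (v * br M1 (mx M1) (my M1))); first by ring.
  rewrite -hv -rmorphM /= -hv' mulr1 /=.
  by rewrite !FK.
have [k [n [a [a0 eGt]]]] : exists k m (a : K), a != 0 /\
    mt M1 ^+ k * G (mt M2) = a *: mt M1 ^+ m.
  apply: (@unit_form _ _ _ _ M1 l1_gt0 _ (G (mti M2))).
  by rewrite -rmorphM m_ti rmorph1.
(* Otherwise G t2, and hence t2, would be a scalar, but t2 is transcendental over K. *)
have kn : k != n.
  apply/eqP => kn; rewrite kn in eGt.
  have Gt : G (mt M2) = a%:A.
    apply: (mulUI M1 (tn_neq0 (M := M1) (n := n))).
    by rewrite eGt -scalerAr mulr1.
  have : e0 M2 ('X - a%:P) = 0.
    by rewrite e0B e0X e0C -(GK (mt M2)) Gt linearZ rmorph1 subrr.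
  by move/e0_inj/eqP; rewrite polyXsubC_eq0.
(* A root of a lam ^ (n - k) = 1, taken according to the sign of n - k; at t1 = lam the image of t2
   takes the value 1. *)
have [lam lam0 lamE] : exists2 lam : K, lam != 0 & a * lam ^+ n = lam ^+ k.
  have aV : a^-1 != 0 by rewrite invr_eq0.
  case: (ltngtP k n) kn => // h _.
    have kn0 : (0 < n - k)%N by rewrite subn_gt0.
    exists ((n - k).-root a^-1); first by rewrite rootC_eq0.
    have rE := rootCK kn0 a^-1; set r := _.-root _ in rE *.
    by rewrite -[in LHS](subnK (ltnW h)) exprD rE mulrA divff // mul1r.
  have kn0 : (0 < k - n)%N by rewrite subn_gt0.
  exists ((k - n).-root a); first by rewrite rootC_eq0.
  have rE := rootCK kn0 a; set r := _.-root _ in rE *.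
  by rewrite -[in RHS](subnK (ltnW h)) exprD rE.
pose m u := rho M1 lam0 l1_gt0 (G u).
have mD u u' : m (u + u') = m u + m u' by rewrite /m rmorphD rhoD.
have mZ c u : m (c *: u) = c *: m u by rewrite /m linearZ rhoZ.
have m_br u u' : m (br M2 u u') = 0.
  rewrite /m -[u in br M2 u]GK -[u']GK hv.
  (* The unit [v] is central for the bracket, so it can be moved into an argument. *)
  have -> : v * br M1 (G u) (G u') = br M1 (v * G u) (G u').
    by rewrite (derM (br_l_der M1 _)) [br M1 v _]br_alt (br_unit M1 l1_gt0 _ vv); ring.
  exact: rho_br.
have m_t u : m (mt M2 * u) = m u.
  rewrite /m rmorphM; apply: (@scalerI _ _ (lam ^+ k)); first by rewrite expf_neq0.
  by rewrite -rho_tn mulrA eGt -scalerAl rhoZ rho_tn scalerA lamE.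
(* The powers of y1 hit nonzero multiples of all l1 - 1 basis vectors, while [m_span] generates the
   image by l2 - 1 vectors. *)
have full : row_full (mgens M2 m).
  rewrite -sub1mx; apply/row_subP => j; rewrite row1.
  have := m_span l2_ge2 mD mZ m_br m_t (F (my M1 ^+ j)).
  rewrite /m FK rho_yn => h.
  rewrite -[delta_mx 0 j]scale1r -(@mulfV _ (j.+1%:R : K)) ?pnatr_eq0 // -scalerA.
  exact: scalemx_sub.
have := rank_leq_row (mgens M2 m); rewrite (eqP full); lia.
Qed.

(** * The localization as a model *)

Local Notation "p %:F" := (@FracField.tofrac _ p).

Section MPLocTheory.
Variables (K : idomainType) (n : nat) (f : {mpoly K[n]}).
Hypothesis f0 : f != 0.
Local Notation U := (mploc f).
Local Notation io := (@mploc_of K n f).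

Lemma mploc_of_inj : injective io.
Proof. by move=> p q /(congr1 val) /= /eqP; rewrite tofrac_eq => /eqP. Qed.

Lemma mploc_ofM p q : io (p * q) = io p * io q. Proof. exact: rmorphM. Qed.
Lemma mploc_ofX p k : io (p ^+ k) = io p ^+ k. Proof. exact: rmorphXn. Qed.
Lemma mploc_ofD p q : io (p + q) = io p + io q. Proof. exact: rmorphD. Qed.
Lemma mploc_ofN p : io (- p) = - io p. Proof. exact: rmorphN. Qed.
Lemma mploc_of1 : io 1 = 1. Proof. exact: rmorph1. Qed.

Lemma mploc_domain (a b : U) : a * b = 0 -> a = 0 \/ b = 0.
Proof.
move=> /(congr1 val); rewrite rmorphM rmorph0 => /eqP; rewrite mulf_eq0.
by case/orP => /eqP h; [left | right]; apply: val_inj; rewrite h rmorph0.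
Qed.

Fact mploc_inv_proof : (f%:F^-1) \in mploc_pred f.
Proof. by apply/asboolP; exists 1, 1%N; rewrite tofrac1 mul1r expr1. Qed.

Definition mploc_inv : U := MPLoc mploc_inv_proof.

Lemma mploc_invP : io f * mploc_inv = 1.
Proof. by apply: val_inj; rewrite rmorphM rmorph1 /= divff // tofrac_eq0. Qed.

Lemma mploc_rep (u : U) : exists pk : {mpoly K[n]} * nat, io f ^+ pk.2 * u = io pk.1.
Proof.
case: u => u hu; have /asboolP[p [k uE]] := hu; exists (p, k); apply: val_inj.
rewrite rmorphM rmorphXn /= uE mulrC divfK //.
by rewrite expf_neq0 // tofrac_eq0.
Qed.

Lemma mploc_scaleE (c : K) (u : U) : c *: u = io c%:MP * u.
Proof. by []. Qed.

Lemma mploc_scalar (c : K) : (c%:A : U) = io c%:MP.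
Proof. exact: mulr1. Qed.

Definition mploc_num (u : U) := (sval (cid (mploc_rep u))).1.
Definition mploc_exp (u : U) := (sval (cid (mploc_rep u))).2.

Lemma mploc_numP u : io f ^+ mploc_exp u * u = io (mploc_num u).
Proof. exact: svalP (cid (mploc_rep u)). Qed.

(* A bracket on the polynomial ring for which f is central extends to the
   localization by clearing denominators. *)
Variable B : {mpoly K[n]} -> {mpoly K[n]} -> {mpoly K[n]}.
Hypothesis B_fl : forall p q, B (f * p) q = f * B p q.
Hypothesis B_fr : forall p q, B p (f * q) = f * B p q.

Definition mploc_br (u v : U) : U :=
  mploc_inv ^+ (mploc_exp u + mploc_exp v) * io (B (mploc_num u) (mploc_num v)).

Lemma mploc_invK k u : mploc_inv ^+ k * (io f ^+ k * u) = u.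
Proof. by rewrite mulrA -exprMn [mploc_inv * _]mulrC mploc_invP expr1n mul1r. Qed.

Lemma B_flX j a b : B (f ^+ j * a) b = f ^+ j * B a b.
Proof. by elim: j => [|j IH]; rewrite ?mul1r // !exprS -!mulrA B_fl IH. Qed.

Lemma B_frX j a b : B a (f ^+ j * b) = f ^+ j * B a b.
Proof. by elim: j => [|j IH]; rewrite ?mul1r // !exprS -!mulrA B_fr IH. Qed.

(** The fractions chosen in [mploc_br] do not matter: numerators of one element agree after
    multiplication by powers of f, which pass through [B]. *)
Lemma mploc_brE u v p q k m : io f ^+ k * u = io p -> io f ^+ m * v = io q ->
  io f ^+ (k + m) * mploc_br u v = io (B p q).
Proof.
move=> eu ev; rewrite /mploc_br.
have := mploc_numP v; have := mploc_numP u.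
move: (mploc_exp u) (mploc_exp v) (mploc_num u) (mploc_num v) => k' m' p' q' eu' ev'.
have ep : f ^+ k' * p = f ^+ k * p'.
  by apply: mploc_of_inj; rewrite !mploc_ofM !mploc_ofX -eu -eu' mulrCA.
have eq : f ^+ m' * q = f ^+ m * q'.
  by apply: mploc_of_inj; rewrite !mploc_ofM !mploc_ofX -ev -ev' mulrCA.
have Bff j i a b : f ^+ (j + i) * B a b = B (f ^+ j * a) (f ^+ i * b).
  by rewrite B_flX B_frX mulrA exprD.
have : f ^+ (k' + m') * B p q = f ^+ (k + m) * B p' q' by rewrite !Bff ep eq.
move/(congr1 io); rewrite !mploc_ofM !mploc_ofX => e.
rewrite mulrCA -e; exact: mploc_invK.
Qed.

Lemma mploc_br_of p q : mploc_br (io p) (io q) = io (B p q).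
Proof.
by have := @mploc_brE (io p) (io q) p q 0 0; rewrite !mul1r => ->.
Qed.

Hypothesis BD : forall p q r, B p (q + r) = B p q + B p r.
Hypothesis BM : forall p q r, B p (q * r) = B p q * r + q * B p r.
Hypothesis BZ : forall c p q, B p (c%:MP * q) = c%:MP * B p q.
Hypothesis BN : forall p q, B q p = - B p q.

Lemma mploc_fI k (u v : U) : io f ^+ k * u = io f ^+ k * v -> u = v.
Proof. by move=> e; rewrite -(mploc_invK k u) e mploc_invK. Qed.

Lemma mploc_rep2 (u : U) : exists k p, io f ^+ k * u = io p.
Proof. by have [[p k] /= e] := mploc_rep u; exists k, p. Qed.

Lemma mploc_br_alt u v : mploc_br v u = - mploc_br u v.
Proof.
have [k [p eu]] := mploc_rep2 u; have [m [q ev]] := mploc_rep2 v.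
apply: (@mploc_fI (k + m)); rewrite mulrN (mploc_brE eu ev) addnC (mploc_brE ev eu).
by rewrite BN mploc_ofN.
Qed.

Lemma mploc_br_der a : is_derivation (mploc_br a).
Proof.
have [n' [r ea]] := mploc_rep2 a.
split=> [u v|u v|c u]; have [k [p eu]] := mploc_rep2 u.
- have [m [q ev]] := mploc_rep2 v.
  have eu' : io f ^+ (k + m) * u = io (f ^+ m * p).
    by rewrite mploc_ofM mploc_ofX -eu addnC exprD mulrA.
  have ev' : io f ^+ (k + m) * v = io (f ^+ k * q).
    by rewrite mploc_ofM mploc_ofX -ev exprD mulrA.
  have euv : io f ^+ (k + m) * (u + v) = io (f ^+ m * p + f ^+ k * q).
    by rewrite mploc_ofD -eu' -ev' mulrDr.
  apply: (@mploc_fI (n' + (k + m))); rewrite (mploc_brE ea euv) BD mploc_ofD mulrDr.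
  by rewrite (mploc_brE ea eu') (mploc_brE ea ev').
- have [m [q ev]] := mploc_rep2 v.
  have euv : io f ^+ (k + m) * (u * v) = io (p * q).
    by rewrite mploc_ofM -eu -ev exprD mulrACA.
  apply: (@mploc_fI (n' + (k + m))); rewrite (mploc_brE ea euv) BM mploc_ofD !mploc_ofM mulrDr.
  have -> : io f ^+ (n' + (k + m)) * (mploc_br a u * v) =
      io f ^+ (n' + k) * mploc_br a u * (io f ^+ m * v).
    by rewrite addnA exprD mulrACA.
  have -> : io f ^+ (n' + (k + m)) * (u * mploc_br a v) =
      io f ^+ k * u * (io f ^+ (n' + m) * mploc_br a v).
    by rewrite addnCA exprD mulrACA.
  by rewrite (mploc_brE ea eu) (mploc_brE ea ev) eu ev.
have euv : io f ^+ k * (c *: u) = io (c%:MP * p).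
  by transitivity (io c%:MP * (io f ^+ k * u)); [exact: mulrCA | rewrite eu mploc_ofM].
apply: (@mploc_fI (n' + k)); rewrite (mploc_brE ea euv) BZ mploc_ofM mploc_scaleE mulrCA.
by rewrite (mploc_brE ea eu).
Qed.

Lemma mploc_gen (P : U -> Prop) : (forall c : K, P c%:A) ->
  (forall a b, P a -> P b -> P (a + b)) ->
  (forall a b, P a -> P b -> P (a * b)) -> (forall i, P (io 'X_i)) ->
  forall u, exists k, P (io f ^+ k * u).
Proof.
move=> PC PD PM PX u; have [k [p e]] := mploc_rep2 u; exists k; rewrite {}e.
have P1 : P (io 1) by rewrite -mpolyC1 -mploc_scalar.
have PX' m : P (io 'X_[m]).
  rewrite mpolyXE_id; apply: (big_ind (fun q => P (io q))) => //.
    by move=> a b ha hb; rewrite mploc_ofM; apply: PM.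
  by move=> i _; elim: (m i) => [|j IH] //; rewrite exprS mploc_ofM; apply: PM.
elim/mpolyind: p => [|c m p _ _ Pp]; first by rewrite -(mpolyC0 n) -mploc_scalar.
rewrite -mul_mpolyC mploc_ofD mploc_ofM; apply: (PD) => //.
by apply: (PM) => //; rewrite -mploc_scalar.
Qed.

End MPLocTheory.

Section Bracket.
Variable K : numClosedFieldType.
Local Notation R3 := {mpoly K[3]}.
Local Notation X := ('X_(0 : 'I_3) : R3).
Local Notation Y := ('X_(1 : 'I_3) : R3).
Local Notation Z := ('X_(2 : 'I_3) : R3).

(** The Jacobian determinant of (f, p, q) expanded along f, with the sign that makes the bracket of
    x and y equal to + x ^ d. *)
Definition jac_br (f p q : R3) : R3 :=
  - (f^`M(0) * (p^`M(1) * q^`M(2%:R) - p^`M(2%:R) * q^`M(1)))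
  + f^`M(1) * (p^`M(0) * q^`M(2%:R) - p^`M(2%:R) * q^`M(0))
  - f^`M(2%:R) * (p^`M(0) * q^`M(1) - p^`M(1) * q^`M(0)).

Lemma jac_br_alt f p q : jac_br f q p = - jac_br f p q.
Proof.
have H (A : comNzRingType) (a b c p1 p2 p3 q1 q2 q3 : A) :
  - (a * (q2 * p3 - q3 * p2)) + b * (q1 * p3 - q3 * p1) - c * (q1 * p2 - q2 * p1) =
  - (- (a * (p2 * q3 - p3 * q2)) + b * (p1 * q3 - p3 * q1) - c * (p1 * q2 - p2 * q1)).
  by ring.
exact: H.
Qed.

Lemma jac_brD f p q r : jac_br f p (q + r) = jac_br f p q + jac_br f p r.
Proof.
have H (A : comNzRingType) (a b c p1 p2 p3 q1 q2 q3 r1 r2 r3 : A) :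
  - (a * (p2 * (q3 + r3) - p3 * (q2 + r2)))
  + b * (p1 * (q3 + r3) - p3 * (q1 + r1)) - c * (p1 * (q2 + r2) - p2 * (q1 + r1)) =
  (- (a * (p2 * q3 - p3 * q2)) + b * (p1 * q3 - p3 * q1) - c * (p1 * q2 - p2 * q1)) +
  (- (a * (p2 * r3 - p3 * r2)) + b * (p1 * r3 - p3 * r1) - c * (p1 * r2 - p2 * r1)).
  by ring.
by rewrite /jac_br !mderivD; apply: H.
Qed.

Lemma jac_brM f p q r : jac_br f p (q * r) = jac_br f p q * r + q * jac_br f p r.
Proof.
have H (A : comNzRingType) (a b c s t p1 p2 p3 q1 q2 q3 r1 r2 r3 : A) :
  - (a * (p2 * (q3 * t + s * r3) - p3 * (q2 * t + s * r2)))
  + b * (p1 * (q3 * t + s * r3) - p3 * (q1 * t + s * r1))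
  - c * (p1 * (q2 * t + s * r2) - p2 * (q1 * t + s * r1)) =
  (- (a * (p2 * q3 - p3 * q2)) + b * (p1 * q3 - p3 * q1) - c * (p1 * q2 - p2 * q1)) * t +
  s * (- (a * (p2 * r3 - p3 * r2)) + b * (p1 * r3 - p3 * r1) - c * (p1 * r2 - p2 * r1)).
  by ring.
by rewrite /jac_br !mderivM; apply: H.
Qed.

Lemma jac_brZ f c p q : jac_br f p (c%:MP * q) = c%:MP * jac_br f p q.
Proof.
rewrite jac_brM (_ : jac_br f p c%:MP = 0) ?mul0r ?add0r //.
have H (A : comNzRingType) (a b c' p1 p2 p3 : A) :
  - (a * (p2 * 0 - p3 * 0)) + b * (p1 * 0 - p3 * 0) - c' * (p1 * 0 - p2 * 0) = 0.
  by ring.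
by rewrite /jac_br !mderivC; apply: H.
Qed.

Lemma jac_br_f f p : jac_br f p f = 0.
Proof.
have H (A : comNzRingType) (q1 q2 q3 p1 p2 p3 : A) :
  - (q1 * (p2 * q3 - p3 * q2)) + q2 * (p1 * q3 - p3 * q1) - q3 * (p1 * q2 - p2 * q1) = 0.
  by ring.
exact: H.
Qed.

Lemma jac_br_fr f p q : jac_br f p (f * q) = f * jac_br f p q.
Proof. by rewrite jac_brM jac_br_f mul0r add0r. Qed.

Lemma jac_br_fl f p q : jac_br f (f * p) q = f * jac_br f p q.
Proof. by rewrite jac_br_alt jac_br_fr jac_br_alt mulrN opprK. Qed.

Lemma mderivU (i j : 'I_3) : ('X_j : R3)^`M(i) = (j == i)%:R.
Proof.
rewrite mderivX mnm1E; case: eqP => [->|_]; last by rewrite scale0r.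
rewrite scale1r (_ : (U_(i) - U_(i))%MM = 0%MM) ?mpolyX0 //.
by apply/mnmP => k; rewrite mnmBE subnn mnm0E.
Qed.

Lemma mderivUX (i j : 'I_3) n :
  ('X_j ^+ n : R3)^`M(i) = n%:R * 'X_j ^+ n.-1 * (j == i)%:R.
Proof.
have hD : is_derivation (mderiv i : R3 -> R3).
  split=> [a b|a b|c a]; [exact: mderivD | exact: mderivM | exact: mderivZ].
by rewrite (derX hD) /= mderivU.
Qed.

Variables (d l : nat).
Hypothesis l_gt0 : (0 < l)%N.

Definition fpoly : R3 := Y ^+ l + X - X ^+ d * Z.

Lemma fpoly_dx : fpoly^`M(0) = 1 - d%:R * X ^+ d.-1 * Z.
Proof.
by rewrite /fpoly mderivB mderivD mderivM !mderivUX !mderivU /= !mulr0 !mulr1 addr0 add0r.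
Qed.

Lemma fpoly_dy : fpoly^`M(1) = l%:R * Y ^+ l.-1.
Proof.
by rewrite /fpoly mderivB mderivD mderivM !mderivUX !mderivU /= !mulr0 !mulr1 mul0r !addr0 subr0.
Qed.

Lemma fpoly_dz : fpoly^`M(2%:R) = - X ^+ d.
Proof.
by rewrite /fpoly mderivB mderivD mderivM !mderivUX !mderivU /= !mulr0 !mulr1 mul0r !add0r.
Qed.

Let jac_eval (A : comNzRingType) (a b c : A) :
  [/\ - (a * (0 * 0 - 0 * 1)) + b * (1 * 0 - 0 * 0) - - c * (1 * 1 - 0 * 0) = c,
      - (a * (0 * 1 - 0 * 0)) + b * (1 * 1 - 0 * 0) - - c * (1 * 0 - 0 * 0) = b &
      - ((1 - a) * (1 * 1 - 0 * 0)) + b * (0 * 1 - 0 * 0) - - c * (0 * 0 - 1 * 0) = a - 1].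
Proof. by split; ring. Qed.

Lemma jac_xy : jac_br fpoly X Y = X ^+ d.
Proof.
rewrite /jac_br fpoly_dx fpoly_dy fpoly_dz !mderivU /=.
by case: (jac_eval (1 - d%:R * X ^+ d.-1 * Z) (l%:R * Y ^+ l.-1) (X ^+ d)).
Qed.

Lemma jac_xz : jac_br fpoly X Z = l%:R * Y ^+ l.-1.
Proof.
rewrite /jac_br fpoly_dx fpoly_dy fpoly_dz !mderivU /=.
by case: (jac_eval (1 - d%:R * X ^+ d.-1 * Z) (l%:R * Y ^+ l.-1) (X ^+ d)).
Qed.

Lemma jac_yz : jac_br fpoly Y Z = d%:R * X ^+ d.-1 * Z - 1.
Proof.
rewrite /jac_br fpoly_dx fpoly_dy fpoly_dz !mderivU /=.
by case: (jac_eval (d%:R * X ^+ d.-1 * Z) (l%:R * Y ^+ l.-1) (X ^+ d)).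
Qed.

(** Restriction to the line x = z = 0, where f becomes y ^ l; since y ^ l is transcendental over K,
    so is f modulo x. *)
Definition yline : R3 -> {poly K} :=
  mmap (@polyC K) (fun i : 'I_3 => if i == 1 then 'X else 0).

HB.instance Definition _ := GRing.RMorphism.on yline.

Lemma ylineX i : yline 'X_i = if i == 1 then 'X else 0.
Proof. by rewrite /yline mmapX mmap1U. Qed.

Lemma yline_fpoly : yline fpoly = 'X ^+ l.
Proof.
rewrite /fpoly rmorphB rmorphD rmorphM !rmorphXn /= !ylineX /=.
by rewrite mulr0 addr0 subr0.
Qed.

Lemma yline_comp a : yline (horner_alg fpoly a) = a \Po 'X^l.
Proof.
elim/poly_ind: a => [|a c IH]; first by rewrite comp_poly0 !rmorph0.
have -> : horner_alg fpoly (a * 'X + c%:P) = horner_alg fpoly a * fpoly + c%:A.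
  by rewrite rmorphD rmorphM /= horner_algX horner_algC.
rewrite comp_polyD comp_polyM comp_polyX comp_polyC.
rewrite rmorphD rmorphM /= yline_fpoly IH; congr (_ + _).
by rewrite -mul_mpolyC mulr1 /yline mmapC.
Qed.

Lemma fpoly_neq0 : fpoly != 0.
Proof.
apply/eqP => f0; have := yline_fpoly; rewrite f0 [yline 0]rmorph0 => /eqP.
by rewrite eq_sym expf_eq0 polyX_eq0 andbF.
Qed.

Lemma fpoly_rel : Y ^+ l + X - fpoly = X ^+ d * Z.
Proof. by rewrite /fpoly opprB addrC subrK. Qed.

Lemma mploc_horner a :
  horner_alg (mploc_of fpoly fpoly) a = mploc_of fpoly (horner_alg fpoly a).
Proof.
elim/poly_ind: a => [|a c IH]; first by rewrite !rmorph0.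
have -> : horner_alg fpoly (a * 'X + c%:P) = horner_alg fpoly a * fpoly + c%:A.
  by rewrite rmorphD rmorphM /= horner_algX horner_algC.
have -> : horner_alg (mploc_of fpoly fpoly) (a * 'X + c%:P) =
    horner_alg (mploc_of fpoly fpoly) a * mploc_of fpoly fpoly + c%:A.
  by rewrite rmorphD rmorphM /= horner_algX horner_algC.
rewrite IH mploc_scalar (mploc_ofD fpoly (horner_alg fpoly a * fpoly)).
by rewrite (mploc_ofM fpoly (horner_alg fpoly a)) -[c%:A]mul_mpolyC mulr1.
Qed.

Lemma X_nonfactor a p k : fpoly ^+ k * horner_alg fpoly a = X * p -> a = 0.
Proof.
move/(congr1 yline); rewrite !rmorphM rmorphXn /= yline_comp yline_fpoly ylineX /= mul0r.
move/eqP; rewrite mulf_eq0 -exprM expf_eq0 polyX_eq0 andbF /= comp_poly_eq0.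
  by move/eqP.
by rewrite size_polyXn ltnS.
Qed.

Lemma mploc_model : model d l (mploc fpoly : comAlgType K).
Proof.
pose io := @mploc_of K 3 fpoly.
have f0 := fpoly_neq0.
have io_nat k : mploc_of fpoly k%:R = k%:R by apply: rmorph_nat.
pose br_ := mploc_br f0 (jac_br fpoly).
have br_io := mploc_br_of f0 (jac_br_fl fpoly) (jac_br_fr fpoly).
apply: (@Model K d l (mploc fpoly) (io X) (io Y) (io Z) (io fpoly) (mploc_inv fpoly) br_).
- exact: mploc_domain.
- by rewrite -!mploc_ofX -mploc_ofM -fpoly_rel !mploc_ofD mploc_ofN.
- exact: mploc_invP.
- move=> P PC PD PM PX PY PZ; apply: mploc_gen => // -[[|[|[|i]]] hi] //.
- move=> e; have : io X = io 0 by rewrite e; apply: esym; apply: rmorph0.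
  move/mploc_of_inj/(congr1 (mderiv 0)).
  by rewrite mderivU mderiv0 => /eqP; rewrite oner_eq0.
- move=> a u; rewrite mploc_horner => e; have [k [p up]] := mploc_rep2 f0 u.
  apply: (@X_nonfactor a p k); apply: (mploc_of_inj (f := fpoly)).
  by rewrite (mploc_ofM fpoly (fpoly ^+ k)) mploc_ofX e (mploc_ofM fpoly X) -up mulrCA.
- move=> a; apply: mploc_br_der.
  + exact: jac_br_fl.
  + exact: jac_br_fr.
  + exact: jac_brD.
  + exact: jac_brM.
  + exact: jac_brZ.
- move=> a b; apply: mploc_br_alt.
  + exact: jac_br_fl.
  + exact: jac_br_fr.
  + exact: jac_br_alt.
- move=> a; have [k [p up]] := mploc_rep2 f0 a.
  apply: (mploc_fI f0 (k := k + 0)); rewrite mulr0.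
  have up0 : io fpoly ^+ 0 * io fpoly = io fpoly by rewrite mul1r.
  rewrite (mploc_brE f0 (jac_br_fl fpoly) (jac_br_fr fpoly) up up0) jac_br_f.
  exact: rmorph0.
- by rewrite /br_ br_io jac_xy mploc_ofX.
- by rewrite /br_ br_io jac_xz mploc_ofM mploc_ofX io_nat.
by rewrite /br_ br_io jac_yz mploc_ofD mploc_ofN mploc_of1 2!mploc_ofM mploc_ofX io_nat.
Qed.

End Bracket.

(** * Assembly of the cases *)

Lemma lrmorphism_inverse (K : nzRingType) (A B : lalgType K) (F : {lrmorphism A -> B}) :
  bijective F -> exists G : {lrmorphism B -> A}, cancel F G /\ cancel G F.
Proof.
case=> g FK GK.
have gZ : zmod_morphism g := can2_zmod_morphism FK GK.
have gM : monoid_morphism g := can2_monoid_morphism FK GK.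
have gS : scalable g by move=> c u; apply: (can_inj FK); rewrite GK linearZ /= GK.
pose G : {lrmorphism B -> A} := HB.pack g (GRing.isZmodMorphism.Build _ _ g gZ)
  (GRing.isMonoidMorphism.Build _ _ g gM) (GRing.isScalable.Build _ _ _ _ g gS).
by exists G.
Qed.

Lemma iso_exponents (K : numClosedFieldType) (d1 l1 d2 l2 : nat) (U1 U2 : comAlgType K)
    (M1 : model d1 l1 U1) (M2 : model d2 l2 U2)
    (F : {lrmorphism U1 -> U2}) (G : {lrmorphism U2 -> U1}) :
  cancel F G -> cancel G F -> (1 <= d1)%N -> (1 <= d2)%N -> (2 <= l1)%N -> (2 <= l2)%N ->
  (d1, l1) = (d2, l2).
Proof.
move=> FK GK d1_gt0 d2_gt0 l1_ge2 l2_ge2.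
have [e1|n1] := eqVneq d1 1%N; have [e2|n2] := eqVneq d2 1%N.
- subst d1 d2; congr (_, _); apply/eqP; rewrite eqn_leq.
  by rewrite (iso_le_d1 M1 M2 FK GK) // (iso_le_d1 M2 M1 GK FK).
- by subst d1; case: (no_iso_d1 M1 M2 FK GK) => //; [apply: ltnW | rewrite ltn_neqAle eq_sym n2].
- by subst d2; case: (no_iso_d1 M2 M1 GK FK) => //; [apply: ltnW | rewrite ltn_neqAle eq_sym n1].
have d1_ge2 : (2 <= d1)%N by rewrite ltn_neqAle eq_sym n1.
have d2_ge2 : (2 <= d2)%N by rewrite ltn_neqAle eq_sym n2.
have [d21 l21] := iso_le M1 M2 FK GK d1_ge2 l1_ge2 d2_ge2 l2_ge2.
have [d12 l12] := iso_le M2 M1 GK FK d2_ge2 l2_ge2 d1_ge2 l1_ge2.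
have ed : d1 = d2 by apply/eqP; rewrite eqn_leq d12 d21.
by congr (_, _) => //; apply/eqP; rewrite eqn_leq l12 // l21.
Qed.

Theorem mainTheorem2 (R : realType) (d d' l l' : nat) :
  (1 <= d)%N -> (1 <= d')%N -> (2 <= l)%N -> (2 <= l')%N ->
  isomorphic_algebras (coordU R d l) (coordU R d' l') ->
  (d, l) = (d', l').
Proof.
move=> d_gt0 d'_gt0 l_ge2 l'_ge2 [F /lrmorphism_inverse[G [FK GK]]].
have M : model d l (coordU R d l) := mploc_model R[i] d (ltnW l_ge2).
have M' : model d' l' (coordU R d' l') := mploc_model R[i] d' (ltnW l'_ge2).
exact: (iso_exponents M M' FK GK).
Qed.
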